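(* Let $r\in\mathbb{N}$ and let $\{\varepsilon_{m_1,\ldots,m_r} : m_1,\ldots,m_r\in\mathbb{N}\}$ be independent random variables on a probability space $(\Omega,P)$, each taking only the values $\pm1$, with $P(\varepsilon_{m_1,\ldots,m_r}=1)=P(\varepsilon_{m_1,\ldots,m_r}=-1)=\tfrac12$. Let $X(m_1,\ldots,m_r)\in\mathbb{R}$ be given real numbers, and for $n\in\mathbb{N}$ and $\omega\in\Omega$ put $$Y_r(n,\omega)=\sum_{\substack{m_1,\ldots,m_r\ge1\\ m_1+\cdots+m_r=n}}\varepsilon_{m_1,\ldots,m_r}(\omega)X(m_1,\ldots,m_r),$$ and consider the random Dirichlet series $$F_r(s,\omega)=\sum_{n=1}^{\infty}Y_r(n,\omega)\,n^{-s}\qquad(s\in\mathbb{C}).$$ Let $\sigma_c(F_r)$ denote the constant such that the abscissa of convergence $\sigma_c(F_r,\omega)$ of this Dirichlet series equals $\sigma_c(F_r)$ for almost every $\omega$, and assume $-\infty<\sigma_c(F_r)<\infty$. Then, almost surely, the line $\Re s=\sigma_c(F_r)$ is the natural boundary of $F_r(s,\omega)$, i.e. the holomorphic function defined by the series on $\Re s>\sigma_c(F_r)$ cannot be analytically continued to a neighbourhood of any point of the line $\Re s=\sigma_c(F_r)$.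
   Context: For each fixed $\omega$ the series $\sum_n Y_r(n,\omega)n^{-s}$ is an ordinary Dirichlet series with abscissa of convergence $\sigma_c(F_r,\omega)\in[-\infty,\infty]$; by the zero-one law this abscissa is almost surely equal to a constant, denoted $\sigma_c(F_r)$. The series $F_r(s,\omega)$ is the multiple series $\sum_{m_1,\ldots,m_r\ge1}\varepsilon_{m_1,\ldots,m_r}(\omega)X(m_1,\ldots,m_r)(m_1+\cdots+m_r)^{-s}$ grouped according to $n=m_1+\cdots+m_r$. *)

(* Defs.v *)
From HB Require Import structures.
From mathcomp Require Import all_boot all_order all_algebra.
From mathcomp Require Import complex.
From mathcomp Require Import all_classical all_reals all_analysis.
Set Implicit Arguments.
Unset Strict Implicit.
Unset Printing Implicit Defensive.
Import Order.TTheory GRing.Theory Num.Theory.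
Import numFieldNormedType.Exports.
Local Open Scope classical_set_scope.
Local Open Scope ring_scope.
Local Open Scope complex_scope.

(* R[i] as a bare type carries no topology; packaged as a numFieldType it is a
   normed module over itself, with the topology of the modulus, and [derivable]
   over it is complex differentiability. *)
Definition cplx (R : realType) : numFieldType := R[i].

Definition cexp (R : realType) (z : cplx R) : cplx R :=
  (expR (complex.Re z) * cos (complex.Im z)) +i*
  (expR (complex.Re z) * sin (complex.Im z)).

(* n ^ (- s) for n >= 1, with the real logarithm of n. *)
Definition npow_opp (R : realType) (n : nat) (s : cplx R) : cplx R :=
  cexp (- (s * (ln (n%:R : R))%:C)).

Section dirichlet_series.
Variable R : realType.
Implicit Types (a : nat -> R) (s : cplx R).

(* The coefficient a 0 is never used. *)
Definition dirichlet_partial a s : nat -> cplx R :=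
  fun N => \sum_(1 <= n < N.+1) (a n)%:C * npow_opp n s.

Definition dirichlet_cvg a s : Prop := cvgn (dirichlet_partial a s).

Definition dirichlet_sum a s : cplx R := limn (dirichlet_partial a s).

Definition abscissa_cvg a : \bar R :=
  ereal_inf [set (complex.Re s)%:E | s in [set s | dirichlet_cvg a s]].

End dirichlet_series.

Definition holomorphic_on (R : realType) (U : set (cplx R))
    (g : cplx R -> cplx R) : Prop :=
  forall z, U z -> derivable g z 1.

(* F is only considered on the half-plane sigma < Re s. *)
Definition continuable_at (R : realType) (sigma : R) (F : cplx R -> cplx R)
    (s0 : cplx R) : Prop :=
  exists U : set (cplx R), exists g : cplx R -> cplx R,
    [/\ open U, U s0, holomorphic_on U g &
        forall s, U s -> sigma < complex.Re s -> g s = F s].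

Definition natural_boundary (R : realType) (sigma : R)
    (F : cplx R -> cplx R) : Prop :=
  forall s0 : cplx R, complex.Re s0 = sigma -> ~ continuable_at sigma F s0.

Definition mutually_independent (d : measure_display) (T : measurableType d)
    (R : realType) (P : probability T R) (I : eqType)
    (X : I -> {RV P >-> R}) : Prop :=
  forall (J : seq I) (B : I -> set R), uniq J ->
    (forall i, measurable (B i)) ->
    P [set w | forall i, i \in J -> B i (X i w)] =
    (\prod_(i <- J) P (X i @^-1` B i))%E.

Definition posnat := {n : nat | (0 < n)%N}.

Definition multi_index (r : nat) := {ffun 'I_r -> posnat}.

Definition weight (r : nat) (m : multi_index r) : nat :=
  (\sum_(i < r) val (m i))%N.

(* The level sets of [weight] are finite, so the [\sum_(_ \in _)] of [Ycoef]
   never takes the value 0 that it has by convention on infinite supports. *)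
Lemma finite_weight (r n : nat) :
  finite_set [set m : multi_index r | weight m = n].
Proof.
pose g (h : {ffun 'I_r -> 'I_n}) : multi_index r :=
  [ffun i => exist (fun k => (0 < k)%N) (h i).+1 isT].
apply: (@sub_finite_set _ _ (g @` setT)); last first.
  exact/finite_image/finite_finset.
move=> m /= mn.
have mi i : ((val (m i)).-1 < n)%N.
  rewrite prednK ?(valP (m i)) // -mn /weight (bigD1 i) //=.
  exact: leq_addr.
exists [ffun i => Ordinal (mi i)] => //.
apply/ffunP => i; apply: val_inj; rewrite !ffunE /=.
by rewrite prednK // (valP (m i)).
Qed.

Definition Ycoef (r : nat) (Omega : Type) (R : realType)
    (eps : multi_index r -> Omega -> R) (X : multi_index r -> R)
    (w : Omega) (n : nat) : R :=
  \sum_(m \in [set m : multi_index r | weight m = n]) eps m w * X m.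

(* Main.v *)
Require Import Defs.
From HB Require Import structures.
From mathcomp Require Import all_boot all_order all_algebra.
From mathcomp Require Import complex.
From mathcomp Require Import all_classical all_reals all_analysis.
From mathcomp Require Import measurable_realfun.
From mathcomp Require Import ring lra.
Set Implicit Arguments.
Unset Strict Implicit.
Unset Printing Implicit Defensive.
Import Order.TTheory GRing.Theory Num.Theory.
Import numFieldNormedType.Exports.
Local Open Scope classical_set_scope.
Local Open Scope ring_scope.

(** Let [V_n] be the sum of the [X(m)^2] with [|m| = n]. If the random
    series could be continued across a point of [Re s = sigma] with positive
    probability, then for some [c = sigma + eta + i t] close to that point the
    sum would extend holomorphically to the disc [|s - c| <= 2 eta], and Cauchy's estimates would
    bound its Taylor coefficients [sum_n Y_n n^(-c) (- ln n)^k / k!] by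
    [C (2 eta)^(-k)] on an event [A] of positive probability. The products
    [eps_i eps_j] are orthonormal, so by Bessel's inequality the second moment
    over [A] of a Rademacher sum supported far in the tail is at least a fixed
    fraction of its full second moment. Hence
    [sum_n V_n n^(-2 (sigma + eta)) (ln n)^(2k) / k!^2 = O((2 eta)^(-2k))], and
    summing over [k] shows that [sum_n V_n n^(-2 sigma')] is finite for some
    [sigma' < sigma]. By Kolmogorov's inequality the series then converges
    almost surely at [sigma'], contradicting the definition of [sigma].

    The Cauchy estimates are obtained from Goursat's theorem for a rectangle in
    the coordinate [w = ln (s - c)]: the function [g(c + e^w) e^(-k w)] has period
    [2 i pi], so its mean over vertical segments does not depend on [Re w]. *)

(** * Goursat's theorem on rectangles *)

(** Continuability is not visibly a measurable event and concerns uncountably many points. It is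
    replaced by [coef_bounded], a measurable condition on partial sums, depending on
    [eta = 1 / (j + 1)], a rational height [t] and a natural bound [C]; countably many null events
    then suffice. Working with partial sums avoids termwise differentiation: on a small circle
    inside the half-plane of convergence they converge uniformly, and their own Taylor coefficients
    are computed exactly.

    The rank from which the bounds hold depends on the outcome and on [k]. An Egorov argument makes
    it uniform on a smaller event, still of positive probability, before second moments are taken.
    The cosine and sine parts are treated separately; adding their squares removes the phase [t].

    The centre lies [eta] to the right of the line and the radius is [2 * eta], so any exponential
    rate below [4 * eta] in [ln n] could be gained for the squares, while more than [2 * eta] is
    required to cross the line. The proof settles for [9 / 4 * eta], whence
    [sigma' = sigma - eta / 8]. *)

Definition RI (R : realType) (f : R -> R) (a b : R) : R :=
  \int[lebesgue_measure]_(x in `[a, b]) f x.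

Section RI_theory.
Variable R : realType.
Implicit Types (f g : R -> R) (a b k : R).
Local Notation mu := (@lebesgue_measure R).

(** Two-sided continuity is asked for even at the end points: [closed_form_at] provides it, and
    sums, differences and products preserve it pointwise. *)
Definition cont_on f (a b : R) := forall x, a <= x <= b -> {for x, continuous f}.

Lemma cont_on_within f a b : cont_on f a b -> {within `[a, b], continuous f}.
Proof.
by move=> cf; apply: continuous_in_subspaceT => x; rewrite inE /= in_itv /=; exact: cf.
Qed.

Lemma cont_on_integrable f a b : cont_on f a b -> mu.-integrable `[a, b] (EFin \o f).
Proof.
move=> cf; apply: continuous_compact_integrable; first exact: segment_compact.
exact: cont_on_within.
Qed.

Lemma RI_split f (a b c : R) : a <= b -> b <= c -> cont_on f a c ->
  RI f a c = RI f a b + RI f b c.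
Proof.
move=> ab bc cf; rewrite /RI.
have I := cont_on_integrable cf.
have := @Rintegral_itvB R f (BLeft a) (BRight c) b I.
rewrite !bnd_simp => /(_ ab bc).
(* [Rintegral_itvB] leaves the interval from [b] to [c] without [b]; adding that point does not
   change the integral. *)
rewrite Rintegral_itv_obnd_cbnd; last first.
  by apply: integrableS I => //; apply: subset_itvr; rewrite bnd_simp.
by move=> <-; ring.
Qed.

Lemma RIB f g (a b : R) : cont_on f a b -> cont_on g a b ->
  RI (fun x => f x - g x) a b = RI f a b - RI g a b.
Proof. by move=> cf cg; rewrite /RI RintegralB //; exact: cont_on_integrable. Qed.

Lemma RID f g (a b : R) : cont_on f a b -> cont_on g a b ->
  RI (fun x => f x + g x) a b = RI f a b + RI g a b.
Proof. by move=> cf cg; rewrite /RI RintegralD //; exact: cont_on_integrable. Qed.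

Lemma RIZ f (k a b : R) : cont_on f a b -> RI (fun x => k * f x) a b = k * RI f a b.
Proof. by move=> cf; rewrite /RI RintegralZl //; exact: cont_on_integrable. Qed.

Lemma eq_RI f g a b : (forall x, a <= x <= b -> f x = g x) -> RI f a b = RI g a b.
Proof. by move=> fg; apply: eq_Rintegral => x; rewrite inE /= in_itv /=; exact: fg. Qed.

Lemma RI_cst k a b : a <= b -> RI (fun=> k) a b = k * (b - a).
Proof.
move=> ab; rewrite /RI Rintegral_cst //= lebesgue_measure_itv /= lte_fin.
case: ltP => // ba; have -> : b = a by apply/eqP; rewrite eq_le ba ab.
by rewrite ?subrr.
Qed.

Lemma cont_on_cst k a b : cont_on (fun=> k) a b.
Proof. by move=> x _; exact: cst_continuous. Qed.

Lemma le_RI f g a b : cont_on f a b -> cont_on g a b ->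
  (forall x, a <= x <= b -> f x <= g x) -> RI f a b <= RI g a b.
Proof.
move=> cf cg fg; apply: le_Rintegral; [by []|exact: cont_on_integrable|exact: cont_on_integrable|].
by move=> x /=; rewrite in_itv /=; exact: fg.
Qed.

Lemma RI_bound f (k E a b : R) : a <= b -> cont_on f a b ->
  (forall x, a <= x <= b -> `|f x - k| <= E) -> `|RI f a b - k * (b - a)| <= E * (b - a).
Proof.
move=> ab cf fE; rewrite ler_distl.
have -> : k * (b - a) - E * (b - a) = RI (fun=> k - E) a b by rewrite RI_cst //; ring.
have -> : k * (b - a) + E * (b - a) = RI (fun=> k + E) a b by rewrite RI_cst //; ring.
apply/andP; split; apply: le_RI => //; try exact: cont_on_cst;
  by move=> x /fE; rewrite ler_distl => /andP[].
Qed.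

End RI_theory.

Section Goursat.
Variables (R : realType) (p q : R -> R -> R) (x1 y1 W H : R).
Hypotheses (W0 : 0 <= W) (H0 : 0 <= H).

(* The coefficient [be] shared by [p] and [q] is what makes [p dx + q dy] closed. *)
Definition closed_form_at (x0 y0 : R) := exists al be ga : R, forall e : R, 0 < e ->
  exists2 d : R, 0 < d & forall x y, `|x - x0| < d -> `|y - y0| < d ->
    `|p x y - p x0 y0 - al * (x - x0) - be * (y - y0)| <= e * (`|x - x0| + `|y - y0|) /\
    `|q x y - q x0 y0 - be * (x - x0) - ga * (y - y0)| <= e * (`|x - x0| + `|y - y0|).

Hypothesis pq : forall x0 y0, x1 <= x0 <= x1 + W -> y1 <= y0 <= y1 + H -> closed_form_at x0 y0.

(** The integral of [p dx + q dy] counterclockwise along the boundary of the rectangle with lower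
    left corner [(x, y)] and sides [w], [h]. *)
Let bnd (x y w h : R) : R :=
  RI (p^~ y) x (x + w) - RI (p^~ (y + h)) x (x + w)
  + (RI (q (x + w)) y (y + h) - RI (q x) y (y + h)).

Let cont_lin (f : R -> R) (x0 al : R) :
  (forall e : R, 0 < e -> exists2 d : R, 0 < d & forall x, `|x - x0| < d ->
    `|f x - f x0 - al * (x - x0)| <= e * `|x - x0|) -> {for x0, continuous f}.
Proof.
move=> h; apply/cvgrPdist_lt => e e0.
have [d d0 hd] := h 1 ltr01.
pose k := `|al| + 2; have k0 : 0 < k by rewrite /k; have := normr_ge0 al; lra.
apply/nbhs_ballP; exists (Num.min d (e / k)) => /=; first by rewrite lt_min d0 divr_gt0.
move=> x; rewrite /ball /= distrC lt_min => /andP[xd xe].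
rewrite distrC.
have -> : f x - f x0 = (f x - f x0 - al * (x - x0)) + al * (x - x0) by ring.
apply: le_lt_trans (ler_normD _ _) _.
rewrite ltr_pdivlMr // in xe.
have := hd _ xd; rewrite normrM /k in xe *.
have := normr_ge0 (x - x0); have := normr_ge0 al; nra.
Qed.

Lemma closed_form_contl x y : x1 <= x <= x1 + W -> y1 <= y <= y1 + H ->
  {for x, continuous (p^~ y)}.
Proof.
move=> hx hy; have [al [be [ga h]]] := pq hx hy.
apply: (@cont_lin _ _ al) => e /h[d d0 hd]; exists d => // t td.
by have [] := hd t y td; rewrite ?subrr ?normr0 ?mulr0 ?addr0 ?subr0.
Qed.

Lemma closed_form_contr x y : x1 <= x <= x1 + W -> y1 <= y <= y1 + H ->
  {for y, continuous (q x)}.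
Proof.
move=> hx hy; have [al [be [ga h]]] := pq hx hy.
apply: (@cont_lin _ _ ga) => e /h[d d0 hd]; exists d => // t td.
by have [] := hd x t _ td; rewrite ?subrr ?normr0 ?mulr0 ?add0r ?subr0.
Qed.

Let inside x y w h := [/\ 0 <= w, 0 <= h, x1 <= x, x + w <= x1 + W & y1 <= y /\ y + h <= y1 + H].

(** Each inner edge is traversed by two neighbouring quarters in opposite directions and cancels. *)
Let bnd_split x y w h : inside x y (w + w) (h + h) -> bnd x y (w + w) (h + h) =
  bnd x y w h + bnd (x + w) y w h + bnd x (y + h) w h + bnd (x + w) (y + h) w h.
Proof.
case=> w0 h0 xl xr [yl yr]; rewrite /bnd !addrA.
have cp z : y1 <= z <= y1 + H -> cont_on (p^~ z) x (x + w + w).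
  by move=> hz t /andP[t1 t2]; apply: closed_form_contl => //; lra.
have cq z : x1 <= z <= x1 + W -> cont_on (q z) y (y + h + h).
  by move=> hz t /andP[t1 t2]; apply: closed_form_contr => //; lra.
rewrite (@RI_split _ (p^~ y) x (x + w) (x + w + w)); [|lra|lra|by apply: cp; lra].
rewrite (@RI_split _ (p^~ (y + h + h)) x (x + w) (x + w + w)); [|lra|lra|by apply: cp; lra].
rewrite (@RI_split _ (q x) y (y + h) (y + h + h)); [|lra|lra|by apply: cq; lra].
rewrite (@RI_split _ (q (x + w + w)) y (y + h) (y + h + h)); [|lra|lra|by apply: cq; lra].
ring.
Qed.

(** One bisection: it passes to a quarter whose boundary integral has at least a fourth of the
    modulus of the whole. The last quarter is a default, justified in [zs_step]. *)
Let pick (n : nat) (z : R * R) : R * R :=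
  let w := W / 2 ^+ n.+1 in let h := H / 2 ^+ n.+1 in
  let b := `|bnd z.1 z.2 (w + w) (h + h)| / 4 in
  if b <= `|bnd z.1 z.2 w h| then z
  else if b <= `|bnd (z.1 + w) z.2 w h| then (z.1 + w, z.2)
  else if b <= `|bnd z.1 (z.2 + h) w h| then (z.1, z.2 + h)
  else (z.1 + w, z.2 + h).

Let zs := fix zs n := if n is m.+1 then pick m (zs m) else (x1, y1).

Let half_split (a : R) n : a / 2 ^+ n = a / 2 ^+ n.+1 + a / 2 ^+ n.+1.
Proof. by rewrite exprS; field; rewrite expf_neq0 // pnatr_eq0. Qed.

Let half_ge0 (a : R) n : 0 <= a -> 0 <= a / 2 ^+ n.
Proof. by move=> a0; rewrite divr_ge0 // exprn_ge0. Qed.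

Let zs_step n : let w := W / 2 ^+ n.+1 in let h := H / 2 ^+ n.+1 in
  [/\ (zs n.+1).1 = (zs n).1 \/ (zs n.+1).1 = (zs n).1 + w,
   (zs n.+1).2 = (zs n).2 \/ (zs n.+1).2 = (zs n).2 + h &
   inside (zs n).1 (zs n).2 (w + w) (h + h) ->
   `|bnd (zs n).1 (zs n).2 (w + w) (h + h)| <= 4 * `|bnd (zs n.+1).1 (zs n.+1).2 w h|].
Proof.
move=> w h; rewrite /= /pick -/w -/h.
set x := (zs n).1; set y := (zs n).2.
set b := _ / 4; have bE : `|bnd x y (w + w) (h + h)| = 4 * b by rewrite /b; field.
case: ifPn => [?|c1]; first by split; [by left|by left|rewrite bE => _; lra].
case: ifPn => [?|c2]; first by split; [by right|by left|rewrite bE => _; rewrite /=; lra].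
case: ifPn => [?|c3]; first by split; [by left|by right|rewrite bE => _; rewrite /=; lra].
(* Three quarters below [b] force the fourth to reach it, since the four integrals add up to one of
   modulus [4 * b]. *)
split; [by right|by right|move=> /bnd_split E].
move: bE; rewrite -!ltNge in c1 c2 c3; rewrite E => bE.
set B4 := bnd (x + w) (y + h) w h in bE *.
have := ler_normD (bnd x y w h + bnd (x + w) y w h + bnd x (y + h) w h) B4.
have := ler_normD (bnd x y w h + bnd (x + w) y w h) (bnd x (y + h) w h).
have := ler_normD (bnd x y w h) (bnd (x + w) y w h).
rewrite bE; lra.
Qed.

Let zs_inside n : inside (zs n).1 (zs n).2 (W / 2 ^+ n) (H / 2 ^+ n).
Proof.
elim: n => [|n [w0 h0 a b [c d]]].
  by rewrite /inside /= expr0 !divr1.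
have [[->|->] [->|->] _] := zs_step n; split; try split;
  rewrite ?half_ge0 //; move: b d; rewrite (half_split W n) (half_split H n);
  have := half_ge0 n.+1 W0; have := half_ge0 n.+1 H0; lra.
Qed.

Let zs_bnd n : `|bnd x1 y1 W H| <= 4 ^+ n * `|bnd (zs n).1 (zs n).2 (W / 2 ^+ n) (H / 2 ^+ n)|.
Proof.
elim: n => [|n IH]; first by rewrite /= !expr0 !divr1 mul1r.
apply: (le_trans IH).
rewrite exprSr -mulrA ler_pM2l ?exprn_gt0 //.
have [_ _] := zs_step n; rewrite -!half_split; apply; exact: zs_inside.
Qed.

Let nested (u : nat -> R) (w : R) : 0 <= w ->
  (forall n, u n.+1 = u n \/ u n.+1 = u n + w / 2 ^+ n.+1) ->
  exists x, forall n, u n <= x <= u n + w / 2 ^+ n.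
Proof.
move=> w0 hu.
have mon n m : u n <= u (n + m)%N.
  elim: m => [|m IH]; first by rewrite addn0.
  by rewrite addnS; have := half_ge0 (n + m).+1 w0; case: (hu (n + m)%N) => ->; lra.
have anti n m : u (n + m)%N + w / 2 ^+ (n + m) <= u n + w / 2 ^+ n.
  elim: m => [|m IH]; first by rewrite addn0.
  rewrite addnS; have := half_ge0 (n + m).+1 w0; have := half_split w (n + m).
  by case: (hu (n + m)%N) => ->; lra.
have ub n m : u m <= u n + w / 2 ^+ n.
  have := mon m n; have := anti n m; rewrite addnC.
  by have := half_ge0 (m + n) w0; lra.
(* Every left end lies below every right end, so the supremum of the left ends belongs to all the
   intervals. *)
exists (sup (range u)) => n; apply/andP; split.
  by apply: ub_le_sup; [exists (u n + w / 2 ^+ n) => _ [m _ <-]|exists n].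
by apply: ge_sup; [by exists (u 0%N), 0%N|move=> _ [m _ <-]].
Qed.

(** The affine parts cancel: in the difference of opposite edges [al] and [ga] drop out, and the
    shared [be] contributes [- be * h * w] horizontally and [be * w * h] vertically. Only the error
    terms remain, at most [2 * e * (w + h)] per unit of length. *)
Let small_bnd x0 y0 x y w h (be e : R) : inside x y w h -> 0 <= e ->
  (exists al ga, forall s t, `|s - x0| <= w -> `|t - y0| <= h ->
    `|p s t - p x0 y0 - al * (s - x0) - be * (t - y0)| <= e * (`|s - x0| + `|t - y0|) /\
    `|q s t - q x0 y0 - be * (s - x0) - ga * (t - y0)| <= e * (`|s - x0| + `|t - y0|)) ->
  x <= x0 <= x + w -> y <= y0 <= y + h ->
  `|bnd x y w h| <= 2 * e * (w + h) ^+ 2.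
Proof.
move=> [w0 h0 xl xr [yl yr]] e0 [al [ga hh]] /andP[xx0 x0x] /andP[yy0 y0y].
have nx s : x <= s <= x + w -> `|s - x0| <= w by move=> ?; rewrite ler_norml; lra.
have ny t : y <= t <= y + h -> `|t - y0| <= h by move=> ?; rewrite ler_norml; lra.
have cp z : y1 <= z <= y1 + H -> cont_on (p^~ z) x (x + w).
  by move=> hz t /andP[t1 t2]; apply: closed_form_contl => //; lra.
have cq z : x1 <= z <= x1 + W -> cont_on (q z) y (y + h).
  by move=> hz t /andP[t1 t2]; apply: closed_form_contr => //; lra.
have cpB : cont_on (fun s => p s y - p s (y + h)) x (x + w).
  by move=> t ht; apply: continuousB; [apply: cp ht|apply: cp ht]; lra.
have cqB : cont_on (fun s => q (x + w) s - q x s) y (y + h).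
  by move=> t ht; apply: continuousB; [apply: cq ht|apply: cq ht]; lra.
rewrite /bnd -RIB; [|by apply: cp; lra|by apply: cp; lra].
rewrite -RIB; [|by apply: cq; lra|by apply: cq; lra].
have xw : x <= x + w by lra.
have yh : y <= y + h by lra.
have E1 := @RI_bound _ _ (- (be * h)) (2 * e * (w + h)) _ _ xw cpB.
have E2 := @RI_bound _ _ (be * w) (2 * e * (w + h)) _ _ yh cqB.
have F1 : forall s, x <= s <= x + w -> `|p s y - p s (y + h) - - (be * h)| <= 2 * e * (w + h).
  move=> s hs; have hy1 : y <= y <= y + h by lra.
  have hy2 : y <= y + h <= y + h by lra.
  have [A _] := hh s y (nx _ hs) (ny _ hy1).
  have [B _] := hh s (y + h) (nx _ hs) (ny _ hy2).
  have C1 := nx _ hs; have C2 := ny _ hy1; have C3 := ny _ hy2.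
  have -> : p s y - p s (y + h) - - (be * h) =
     (p s y - p x0 y0 - al * (s - x0) - be * (y - y0)) -
     (p s (y + h) - p x0 y0 - al * (s - x0) - be * (y + h - y0)) by ring.
  apply: le_trans (ler_normB _ _) _.
  by nra.
have F2 : forall t, y <= t <= y + h -> `|q (x + w) t - q x t - be * w| <= 2 * e * (w + h).
  move=> t ht; have hx1 : x <= x <= x + w by lra.
  have hx2 : x <= x + w <= x + w by lra.
  have [_ A] := hh x t (nx _ hx1) (ny _ ht).
  have [_ B] := hh (x + w) t (nx _ hx2) (ny _ ht).
  have C1 := ny _ ht; have C2 := nx _ hx1; have C3 := nx _ hx2.
  have -> : q (x + w) t - q x t - be * w =
     (q (x + w) t - q x0 y0 - be * (x + w - x0) - ga * (t - y0)) -
     (q x t - q x0 y0 - be * (x - x0) - ga * (t - y0)) by ring.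
  apply: le_trans (ler_normB _ _) _.
  by nra.
have {E1}E1 := E1 F1; have {E2}E2 := E2 F2.
set I1 := RI _ x _ in E1 *; set I2 := RI _ y _ in E2 *.
have -> : I1 + I2 = (I1 - - (be * h) * (x + w - x)) + (I2 - be * w * (y + h - y)) by ring.
apply: le_trans (ler_normD _ _) _.
by apply: le_trans (lerD E1 E2) _; rewrite le_eqVlt; apply/orP; left; apply/eqP; ring.
Qed.

(** After [n] bisections the boundary integral has shrunk at most by the factor [4 ^+ n], whereas
    near the common point of the rectangles [small_bnd] bounds it by an arbitrarily small multiple
    of the inverse of that factor. *)
Lemma goursat : bnd x1 y1 W H = 0.
Proof.
have [x0 hx0] : exists x, forall n, (zs n).1 <= x <= (zs n).1 + W / 2 ^+ n.
  by apply: nested => // n; have [] := zs_step n.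
have [y0 hy0] : exists x, forall n, (zs n).2 <= x <= (zs n).2 + H / 2 ^+ n.
  by apply: nested => // n; have [] := zs_step n.
have rx : x1 <= x0 <= x1 + W by have := hx0 0%N; rewrite /= expr0 divr1.
have ry : y1 <= y0 <= y1 + H by have := hy0 0%N; rewrite /= expr0 divr1.
have [al [be [ga hh]]] := pq rx ry.
apply/normr0_eq0/eqP; rewrite eq_le normr_ge0 andbT.
apply/ler_addgt0Pr => e e0; rewrite add0r.
(* Once the powers of 2 cancel, [small_bnd] leaves the factor [2 * (W + H) ^+ 2]; [K] absorbs it and
   stays positive when the rectangle is a point. *)
pose K := 2 * (W + H) ^+ 2 + 1.
have K0 : 0 < K by rewrite /K; have := sqr_ge0 (W + H); lra.
have eK : 0 < e / K by rewrite divr_gt0.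
have [d d0 hd] := hh _ eK.
pose n := Num.bound ((W + H) / d).
have nd : (W + H) / 2 ^+ n < d.
  rewrite ltr_pdivrMr ?exprn_gt0 // mulrC -ltr_pdivrMr //.
  apply: (lt_trans (_ : _ < n%:R)).
    apply: archi_boundP; rewrite divr_ge0 ?addr_ge0 // ltW //.
  by rewrite -natrX ltr_nat; apply: ltn_expl.
have Wn := half_ge0 n W0; have Hn := half_ge0 n H0.
have sum_n : (W + H) / 2 ^+ n = W / 2 ^+ n + H / 2 ^+ n by rewrite mulrDl.
apply: (le_trans (zs_bnd n)).
have S := @small_bnd x0 y0 (zs n).1 (zs n).2 (W / 2 ^+ n) (H / 2 ^+ n) be (e / K)
  (zs_inside n) (ltW eK) _ (hx0 n) (hy0 n).
apply: (@le_trans _ _ (4 ^+ n * (2 * (e / K) * (W / 2 ^+ n + H / 2 ^+ n) ^+ 2))).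
  rewrite ler_pM2l ?exprn_gt0 //; apply: S; exists al, ga => s t hs ht.
  by apply: hd; lra.
rewrite -sum_n.
have -> : 4 ^+ n = (2 ^+ n) ^+ 2 :> R by rewrite -exprM mulnC exprM; congr (_ ^+ _); ring.
set P := 2 ^+ n; have P0 : P != 0 by rewrite /P expf_neq0 // pnatr_eq0.
have -> : P ^+ 2 * (2 * (e / K) * ((W + H) / P) ^+ 2) = e * (2 * (W + H) ^+ 2 / K).
  by field; rewrite P0 gt_eqF.
rewrite -[leRHS]mulr1 ler_pM2l //.
rewrite ler_pdivrMr // mul1r /K; lra.
Qed.

End Goursat.

(** * Complex differentiability and means over circles *)

Local Open Scope complex_scope.
Import complex.ComplexField.Normc.
Local Notation Re := complex.Re.
Local Notation Im := complex.Im.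

(** * The modulus as a real number, and the rules of complex differentiation *)

Section complex_differentiability.
Variable R : realType.
Implicit Types (z w h D : R[i]) (f g : R[i] -> R[i]).

Lemma normc_sqrt z : normc z = Num.sqrt (Re z ^+ 2 + Im z ^+ 2).
Proof. by case: z. Qed.

Lemma normc_ge0 z : 0 <= normc z.
Proof. by rewrite normc_sqrt sqrtr_ge0. Qed.

Lemma Re_le_normc z : `|Re z| <= normc z.
Proof. by rewrite normc_sqrt -sqrtr_sqr ler_wsqrtr // lerDl sqr_ge0. Qed.

Lemma Im_le_normc z : `|Im z| <= normc z.
Proof. by rewrite normc_sqrt -sqrtr_sqr ler_wsqrtr // lerDr sqr_ge0. Qed.

Lemma normc_real (x : R) : normc x%:C = `|x|.
Proof. by rewrite normc_sqrt /= expr0n addr0 sqrtr_sqr. Qed.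

Lemma normc_im (x : R) : normc (0 +i* x) = `|x|.
Proof. by rewrite normc_sqrt /= expr0n add0r sqrtr_sqr. Qed.

Lemma normc_le z : normc z <= `|Re z| + `|Im z|.
Proof.
rewrite -(normc_real (Re z)) -(normc_im (Im z)).
have {1}-> : z = (Re z)%:C + (0 +i* Im z).
  by case: z => a b; apply/eqP; rewrite eq_complex /= addr0 add0r !eqxx.
exact: le_normcD.
Qed.

Lemma normcX z n : normc (z ^+ n) = normc z ^+ n.
Proof. by elim: n => [|n IH]; rewrite ?expr0 ?normc1 // !exprS normcM IH. Qed.

(** A form with real tolerances and an explicit derivative, from which the real expansions in
    [closed_form_at] are read off by taking components. [cdiff_derivable] connects it with
    [derivable] on [cplx R]. *)
Definition cdiff f D z := forall e : R, 0 < e -> exists2 d : R, 0 < d &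
  forall h, normc h < d -> normc (f (z + h) - f z - D * h) <= e * normc h.

Lemma cdiff_cst (k : R[i]) z : cdiff (fun=> k) 0 z.
Proof.
move=> e e0; exists 1 => // h _.
have -> : k - k - 0 * h = 0 by ring.
by rewrite normc0 mulr_ge0 ?normc_ge0 // ltW.
Qed.

Lemma cdiff_id z : cdiff id 1 z.
Proof.
move=> e e0; exists 1 => // h _.
have -> : z + h - z - 1 * h = 0 by ring.
by rewrite normc0 mulr_ge0 ?normc_ge0 // ltW.
Qed.

Lemma cdiff_lip f D z : cdiff f D z -> exists2 d : R, 0 < d &
  forall h, normc h < d -> normc (f (z + h) - f z) <= (normc D + 1) * normc h.
Proof.
move=> /(_ 1 ltr01)[d d0 hd]; exists d => // h /hd.
have {2}-> : f (z + h) - f z = (f (z + h) - f z - D * h) + D * h by ring.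
move=> H; apply: le_trans (le_normcD _ _) _; rewrite normcM mulrDl addrC lerD2l.
exact: H.
Qed.

Lemma cdiffD f g D E z : cdiff f D z -> cdiff g E z ->
  cdiff (fun w => f w + g w) (D + E) z.
Proof.
move=> hf hg e e0; have e2 : 0 < e / 2 by rewrite divr_gt0.
have [d d0 hd] := hf _ e2; have [d' d'0 hd'] := hg _ e2.
exists (Num.min d d'); rewrite ?lt_min ?d0 // => h; rewrite lt_min => /andP[/hd h1 /hd' h2].
have -> : f (z + h) + g (z + h) - (f z + g z) - (D + E) * h =
  (f (z + h) - f z - D * h) + (g (z + h) - g z - E * h) by ring.
by apply: le_trans (le_normcD _ _) _; lra.
Qed.

Lemma cdiffM f g D E z : cdiff f D z -> cdiff g E z ->
  cdiff (fun w => f w * g w) (D * g z + f z * E) z.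
Proof.
move=> hf hg e e0.
pose K := normc (f z) + normc (g z) + normc D + 2.
have K0 : 0 < K by rewrite /K; have := normc_ge0 (f z); have := normc_ge0 (g z); have := normc_ge0 D; lra.
have eK : 0 < e / (2 * K) by rewrite divr_gt0 // mulr_gt0.
have [d d0 hd] := hf _ eK; have [d' d'0 hd'] := hg _ eK.
have [d1 d10 hd1] := cdiff_lip hf; have [d2 d20 hd2] := cdiff_lip hg.
pose L := (normc D + 1) * (normc E + 1).
have L0 : 0 < L by rewrite mulr_gt0 // ltr_wpDl // normc_ge0.
exists (Num.min (Num.min d d') (Num.min (Num.min d1 d2) (e / (4 * L)))).
  by rewrite !lt_min d0 d'0 d10 d20 divr_gt0 // mulr_gt0.
move=> h; rewrite !lt_min -!andbA => /and5P[/hd A /hd' B /hd1 A1 /hd2 B1 hh].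
have -> : f (z + h) * g (z + h) - f z * g z - (D * g z + f z * E) * h =
  (f (z + h) - f z - D * h) * g z + f z * (g (z + h) - g z - E * h)
  + (f (z + h) - f z) * (g (z + h) - g z) by ring.
apply: le_trans (le_normcD _ _) _.
have H1 := le_normcD ((f (z + h) - f z - D * h) * g z) (f z * (g (z + h) - g z - E * h)).
rewrite !normcM in H1 *.
have H2 : normc (f (z + h) - f z) * normc (g (z + h) - g z) <= e / 4 * normc h.
  apply: (le_trans (ler_pM (normc_ge0 _) (normc_ge0 _) A1 B1)).
  have -> : (normc D + 1) * normc h * ((normc E + 1) * normc h) = L * normc h * normc h.
    by rewrite /L; ring.
  apply: ler_wpM2r; first exact: normc_ge0.
  have L4 : 0 < 4 * L by lra.
  by move: hh; rewrite ltr_pdivlMr // mulrCA [normc h * _]mulrC; move: (L * normc h) => t; lra.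
have H3 : normc (f (z + h) - f z - D * h) * normc (g z) + normc (f z) * normc (g (z + h) - g z - E * h) <= e / 2 * normc h.
  apply: (@le_trans _ _ (e / (2 * K) * normc h * (normc (f z) + normc (g z)))).
    rewrite mulrDr addrC lerD //.
      by rewrite mulrC; apply: ler_wpM2r => //; exact: normc_ge0.
    by apply: ler_wpM2r => //; exact: normc_ge0.
  have -> : e / 2 * normc h = e / (2 * K) * normc h * K.
    by field; rewrite gt_eqF.
  apply: ler_wpM2l; first by rewrite mulr_ge0 ?normc_ge0 // ltW.
  by rewrite /K; have := normc_ge0 D; lra.
have := normc_ge0 h; nra.
Qed.

Lemma cdiff_comp f g D E z : cdiff g E z -> cdiff f D (g z) ->
  cdiff (fun w => f (g w)) (D * E) z.
Proof.
move=> hg hf e e0.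
pose L := normc E + 1; have L0 : 0 < L by rewrite /L ltr_wpDl // normc_ge0.
pose M := normc D + 1; have M0 : 0 < M by rewrite /M ltr_wpDl // normc_ge0.
have eL : 0 < e / (2 * L) by rewrite divr_gt0 // mulr_gt0.
have eM : 0 < e / (2 * M) by rewrite divr_gt0 // mulr_gt0.
have [d d0 hd] := hf _ eL; have [d' d'0 hd'] := hg _ eM; have [d1 d10 hd1] := cdiff_lip hg.
exists (Num.min (Num.min d1 d') (d / L)); first by rewrite !lt_min d'0 d10 divr_gt0.
move=> h; rewrite !lt_min -!andbA => /and3P[/hd1 A /hd' B C].
pose k := g (z + h) - g z.
have gk : g (z + h) = g z + k by rewrite /k; ring.
rewrite ltr_pdivlMr // in C.
have kd : normc k < d by apply: le_lt_trans A _; rewrite mulrC.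
have := hd _ kd; rewrite gk => F.
have -> : f (g z + k) - f (g z) - D * E * h =
  (f (g z + k) - f (g z) - D * k) + D * (k - E * h) by ring.
apply: le_trans (le_normcD _ _) _; rewrite normcM.
have F1 : e / (2 * L) * normc k <= e / 2 * normc h.
  apply: (@le_trans _ _ (e / (2 * L) * (L * normc h))).
    by rewrite ler_pM2l.
  by rewrite le_eqVlt; apply/orP; left; apply/eqP; field; rewrite gt_eqF.
have F2 : normc D * normc (k - E * h) <= e / 2 * normc h.
  apply: (@le_trans _ _ (M * (e / (2 * M) * normc h))).
    by apply: ler_pM; rewrite ?normc_ge0 // /M; lra.
  by rewrite le_eqVlt; apply/orP; left; apply/eqP; field; rewrite gt_eqF.
lra.
Qed.

Lemma cdiffX f D z n : cdiff f D z ->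
  cdiff (fun w => f w ^+ n) (n%:R * f z ^+ n.-1 * D) z.
Proof.
move=> hf; elim: n => [|n IH].
  by rewrite !mul0r; under [X in cdiff X]eq_fun do rewrite expr0; exact: cdiff_cst.
under [X in cdiff X]eq_fun do rewrite exprS.
have -> : n.+1%:R * f z ^+ n.+1.-1 * D = D * f z ^+ n + f z * (n%:R * f z ^+ n.-1 * D).
  by case: n {IH} => [|n] /=; rewrite ?expr0 ?exprS -?[n.+2]addn1 ?natrD; ring.
exact: (cdiffM hf IH).
Qed.

Lemma eq_cdiff f D E z : cdiff f D z -> D = E -> cdiff f E z.
Proof. by move=> ? <-. Qed.

End complex_differentiability.

(** * Real derivatives as first-order expansions *)

Section real_derivative.
Variable R : realType.

Lemma is_derive_expansion (f : R -> R) (x df : R) : is_derive x 1 f df ->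
  forall e : R, 0 < e -> exists2 d : R, 0 < d &
    forall h, `|h| < d -> `|f (x + h) - f x - df * h| <= e * `|h|.
Proof.
move=> [df1 df2] e e0.
have : (fun h => h^-1 *: ((f \o shift x) (h *: 1) - f x)) @ 0^' --> df.
  by rewrite -df2; exact: df1.
move=> /cvgrPdist_le /(_ e e0) /nbhs_ballP[d /= d0 hd]; exists d => // h hd'.
have [->|h0] := eqVneq h 0.
  by rewrite addr0 subrr mulr0 subrr normr0 mulr0.
have := hd h; rewrite /ball /= sub0r normrN => /(_ hd' h0).
rewrite [_ *: 1]mulr1 => H.
have -> : f (x + h) - f x - df * h = - (df - h^-1 * (f (h + x) - f x)) * h.
  rewrite (addrC h x); set u := f (x + h); set v := f x.
  by rewrite -[X in X = _]/(u - v - df * h :> R); field.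
by rewrite normrM normrN ler_wpM2r.
Qed.

Lemma expansion_is_derive (f : R -> R) (x df : R) :
  (forall e : R, 0 < e -> exists2 d : R, 0 < d &
    forall h, `|h| < d -> `|f (x + h) - f x - df * h| <= e * `|h|) ->
  is_derive x 1 f df.
Proof.
move=> H.
have C : (fun h => h^-1 *: ((f \o shift x) (h *: 1) - f x)) @ 0^' --> df.
  apply/cvgrPdist_le => e e0; have [d d0 hd] := H e e0.
  apply/nbhs_ballP; exists d => //= h; rewrite /ball /= sub0r normrN => hd' h0.
  have -> : df - h^-1 *: (f (h *: 1 + x) - f x) = - ((f (x + h) - f x - df * h) / h).
    rewrite [_ *: 1]mulr1 (addrC h x) [_ *: _]/(_ * _); set u := f (x + h); set v := f x.
    by rewrite -[X in X = _]/(df - h^-1 * (u - v) :> R); field.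
  rewrite normrN normrM normfV ler_pdivrMr ?normr_gt0 //; exact: hd.
by apply: DeriveDef; [apply/cvg_ex; exists df|exact: cvg_lim C].
Qed.

Lemma RI_derive (F f : R -> R) (a b : R) : a < b ->
  (forall x : R, is_derive x 1 F (f x)) -> cont_on f a b -> RI f a b = F b - F a.
Proof.
move=> ab dF cf; rewrite /RI /Rintegral (@continuous_FTC2 _ f F) //.
- exact: cont_on_within.
- have cF x : {for x, continuous F}.
    by apply: differentiable_continuous; apply/derivable1_diffP; have [] := dF x.
  split=> [x _| |]; first by have [] := dF x.
    exact/cvg_at_right_filter/cF.
  exact/cvg_at_left_filter/cF.
- by move=> x _; rewrite derive1E; have [_ ->] := dF x.
Qed.

End real_derivative.

(** * The complex exponential *)

Section complex_exponential.
Variable R : realType.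
Implicit Types (z w h D : R[i]) (f g : R[i] -> R[i]).

(** Convertible to [cexp], but typed on [R[i]] like [normc] and [cdiff]. *)
Definition cE z : R[i] := (expR (Re z) * cos (Im z)) +i* (expR (Re z) * sin (Im z)).

Lemma cE0 : cE 0 = 1.
Proof. by rewrite /cE /= expR0 cos0 sin0 mulr1 mulr0. Qed.

Lemma cED z w : cE (z + w) = cE z * cE w.
Proof.
case: z w => [a b] [c d]; rewrite /cE /= expRD cosD sinD.
by apply/eqP; rewrite eq_complex /=; apply/andP; split; apply/eqP; ring.
Qed.

Lemma normc_cE z : normc (cE z) = expR (Re z).
Proof.
rewrite normc_sqrt /= !exprMn -mulrDr cos2Dsin2 mulr1 sqrtr_sqr ger0_norm //.
Qed.

Lemma cE_periodic z : cE (z + (0 +i* (pi *+ 2))) = cE z.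
Proof. by rewrite cED {2}/cE /= expR0 cos2pi sin2pi mulr1 mulr0 mulr1. Qed.

Lemma cdiff_cE0 : cdiff cE 1 (0 : R[i]).
Proof.
move=> e e0.
(* The four error terms below cost 1 + 3 + 3 + 2 = 9 times [e' * normc h]; [e' <= 1] also gives
   [expR a <= 3]. *)
have [e' [e'0 e'1 e'9]] : exists e' : R, [/\ 0 < e', e' <= 1 & e' <= e / 9].
  exists (Num.min 1 (e / 9)).
  by split; rewrite ?ge_min ?lexx ?orbT // lt_min ltr01 divr_gt0.
have [d1 d10 h1] := is_derive_expansion (is_derive_expR (0 : R)) e'0.
have [d2 d20 h2] := is_derive_expansion (is_derive_cos (0 : R)) e'0.
have [d3 d30 h3] := is_derive_expansion (is_derive_sin (0 : R)) e'0.
exists (Num.min (Num.min d1 d2) (Num.min d3 e')); first by rewrite !lt_min d10 d20 d30 e'0.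
move=> h; rewrite !lt_min -!andbA => /and4P[hd1 hd2 hd3 hd4].
have A := Re_le_normc h; have B := Im_le_normc h.
have {h1} := h1 _ (le_lt_trans A hd1); have {h2} := h2 _ (le_lt_trans B hd2).
have {h3} := h3 _ (le_lt_trans B hd3).
rewrite !add0r expR0 cos0 sin0 !mul1r subr0 oppr0 mul0r subr0.
rewrite cE0; set a := Re h in A *; set b := Im h in B * => S C E.
apply: (le_trans (normc_le _)).
have -> : Re (cE h - 1 - h) = (expR a - 1 - a) + expR a * (cos b - 1).
  by rewrite /cE /a /b; case: h {A B S C E hd1 hd2 hd3 hd4 a b} => a b /=; ring.
have -> : Im (cE h - 1 - h) = expR a * (sin b - b) + (expR a - 1) * b.
  by rewrite /cE /a /b; case: h {A B S C E hd1 hd2 hd3 hd4 a b} => a b /=; ring.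
have F1 := ler_normD (expR a - 1 - a) (expR a * (cos b - 1)).
have F2 := ler_normD (expR a * (sin b - b)) ((expR a - 1) * b).
rewrite !normrM in F1 F2.
have G1 : `|expR a - 1| <= 2 * `|a|.
  have -> : expR a - 1 = (expR a - 1 - a) + a by ring.
  by apply: le_trans (ler_normD _ _) _; have := normr_ge0 a; nra.
have G2 : `|expR a| <= 3.
  have -> : expR a = (expR a - 1) + 1 by ring.
  by apply: le_trans (ler_normD _ _) _; rewrite normr1; lra.
have a0 := normr_ge0 a; have b0 := normr_ge0 b; have n0 := normc_ge0 h.
have P1 : `|expR a| * `|cos b - 1| <= 3 * (e' * `|b|) by apply: ler_pM.
have P2 : `|expR a| * `|sin b - b| <= 3 * (e' * `|b|) by apply: ler_pM.
have P3 : `|expR a - 1| * `|b| <= 2 * (e' * `|b|).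
  rewrite mulrA; apply: ler_wpM2r => //; lra.
have Q1 : e' * `|a| <= e' * normc h by rewrite ler_pM2l.
have Q2 : e' * `|b| <= e' * normc h by rewrite ler_pM2l.
have Q3 : 9 * (e' * normc h) <= e * normc h.
  by rewrite mulrA ler_wpM2r //; lra.
lra.
Qed.

(** The addition formula carries the expansion at 0 over to [z]; the factor [cE z] of modulus
    [expR (Re z)] explains the rescaled tolerance. *)
Lemma cdiff_cE z : cdiff cE (cE z) z.
Proof.
move=> e e0; have eK : 0 < e / expR (Re z) by rewrite divr_gt0 // expR_gt0.
have [d d0 hd] := cdiff_cE0 eK; exists d => // h /hd.
rewrite add0r cE0 mul1r cED => H.
have -> : cE z * cE h - cE z - cE z * h = cE z * (cE h - 1 - h) by ring.
rewrite normcM normc_cE.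
apply: le_trans (ler_wpM2l (expR_ge0 _) H) _.
rewrite le_eqVlt; apply/orP; left; apply/eqP; field.
by rewrite gt_eqF // expR_gt0.
Qed.

Lemma cdiff_derivable (g : cplx R -> cplx R) (z : cplx R) :
  derivable g z 1 -> exists D, cdiff (g : R[i] -> R[i]) D z.
Proof.
move=> /cvg_ex[l /cvgrPdist_le H]; exists l => e e0.
have e0' : (0 : cplx R) < (e%:C : R[i]) by rewrite /cplx /= ltcR.
have /nbhs_ballP[d /= d0 hd] := H _ e0'.
(* Radii of balls in [cplx R] are themselves complex; being positive there means having zero
   imaginary part and positive real part. *)
have [Id Rd] : Im (d : R[i]) = 0 /\ 0 < Re (d : R[i]).
  by move: d0; rewrite ltcE /= => /andP[/eqP].
exists (Re (d : R[i])) => // h hh.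
have [->|h0] := eqVneq h 0.
  have -> : g (z + 0) - g z - (l : R[i]) * 0 = 0 :> R[i] by rewrite addr0 subrr mulr0 subrr.
  by rewrite normc0 mulr0.
have dE : d = ((Re (d : R[i]))%:C : R[i]).
  by move: Id; case: (d : R[i]) => a b /= ->.
have := hd h; rewrite /ball /= sub0r normrN => /(_ _ h0).
have -> : (`|h : cplx R| < d) by rewrite dE; change (((normc h)%:C < (Re (d : R[i]))%:C :> R[i])); rewrite ltcR.
move=> /(_ isT).
set q := l - _ => Q.
have {}Q : normc (q : R[i]) <= e.
  by move: Q; change (((normc (q : R[i]))%:C <= e%:C :> R[i]) -> normc (q : R[i]) <= e); rewrite lecR.
have -> : (g (z + h) - g z - (l : R[i]) * h : R[i]) = - ((q : R[i]) * h).
  have -> : (q : R[i]) = (l : R[i]) - h^-1 * (g (z + h) - g z).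
    by rewrite /q; congr (_ - _ * (g _ - _)); rewrite [_ *: _]mulr1 addrC.
  by rewrite mulrBl mulrAC mulVf // mul1r opprB.
by rewrite normcN normcM ler_wpM2r // normc_ge0.
Qed.

End complex_exponential.

(** * Integrals over one period along vertical lines *)

Section circle_means.
Variable R : realType.
Implicit Types (z w h D : R[i]) (f g : R -> R[i]) (F G : R[i] -> R[i]) (x t : R).
Local Notation tau := (pi *+ 2 : R).

Let tau0 : 0 <= tau. Proof. by rewrite mulrn_wge0 // pi_ge0. Qed.
Let tau_gt0 : 0 < tau. Proof. by rewrite pmulrn_lgt0 // pi_gt0. Qed.

(** For [f t = g (c + cE w) * cE (- w) ^+ k] at [w = x +i* t], this is Cauchy's integral over the
    circle of radius [expR x] about [c], that is [2 pi] times the [k]-th Taylor coefficient of a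
    holomorphic [g]. *)
Definition CI f : R[i] := RI (fun t => Re (f t)) 0 tau +i* RI (fun t => Im (f t)) 0 tau.

Definition ccont f := cont_on (fun t => Re (f t)) 0 tau /\ cont_on (fun t => Im (f t)) 0 tau.

Lemma cReD z w : Re (z + w) = Re z + Re w. Proof. by case: z; case: w. Qed.
Lemma cImD z w : Im (z + w) = Im z + Im w. Proof. by case: z; case: w. Qed.
Lemma cReB z w : Re (z - w) = Re z - Re w. Proof. by case: z; case: w. Qed.
Lemma cImB z w : Im (z - w) = Im z - Im w. Proof. by case: z; case: w. Qed.
Lemma cReM z w : Re (z * w) = Re z * Re w - Im z * Im w. Proof. by case: z; case: w. Qed.
Lemma cImM z w : Im (z * w) = Re z * Im w + Im z * Re w.
Proof. by case: z; case: w. Qed.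

Lemma eqcP z w : Re z = Re w -> Im z = Im w -> z = w.
Proof. by case: z w => [a b] [c d] /= -> ->. Qed.

Lemma ccontD f g : ccont f -> ccont g -> ccont (fun t => f t + g t).
Proof.
move=> [f1 f2] [g1 g2]; rewrite /ccont.
have -> : (fun t => Re (f t + g t)) = (fun t => Re (f t) + Re (g t)).
  by apply/funext => t; rewrite cReD.
have -> : (fun t => Im (f t + g t)) = (fun t => Im (f t) + Im (g t)).
  by apply/funext => t; rewrite cImD.
by split=> t ht; apply: continuousD; [exact: f1|exact: g1|exact: f2|exact: g2].
Qed.

Lemma ccontZ k f : ccont f -> ccont (fun t => k * f t).
Proof.
move=> [f1 f2]; rewrite /ccont.
have -> : (fun t => Re (k * f t)) = (fun t => Re k * Re (f t) - Im k * Im (f t)).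
  by apply/funext => t; rewrite cReM.
have -> : (fun t => Im (k * f t)) = (fun t => Re k * Im (f t) + Im k * Re (f t)).
  by apply/funext => t; rewrite cImM.
split=> t ht; [apply: continuousB|apply: continuousD]; apply: continuousM;
  by [exact: cst_continuous|exact: f1|exact: f2].
Qed.

Lemma ccont_cst k : ccont (fun=> k).
Proof. by split=> t _; exact: cst_continuous. Qed.

Lemma ccont_sum (I : Type) (s : seq I) (f : I -> R -> R[i]) :
  (forall i, ccont (f i)) -> ccont (fun t => \sum_(i <- s) f i t).
Proof.
move=> H; elim: s => [|i s IH].
  by under [X in ccont X]eq_fun do rewrite big_nil; exact: ccont_cst.
by under [X in ccont X]eq_fun do rewrite big_cons; exact: ccontD.
Qed.

Lemma CID f g : ccont f -> ccont g -> CI (fun t => f t + g t) = CI f + CI g.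
Proof.
move=> [f1 f2] [g1 g2]; apply: eqcP; rewrite /CI /=.
  by rewrite -RID //; apply: eq_RI => t _; rewrite cReD.
by rewrite -RID //; apply: eq_RI => t _; rewrite cImD.
Qed.

Lemma CIZ k f : ccont f -> CI (fun t => k * f t) = k * CI f.
Proof.
move=> [f1 f2].
have contZ (a : R) (u : R -> R) : cont_on u 0 tau -> cont_on (fun t => a * u t) 0 tau.
  by move=> hu t ht; apply: continuousM; [exact: cst_continuous|exact: hu].
apply: eqcP; rewrite ?cReM ?cImM /CI /= -!RIZ //.
  rewrite -RIB //; try exact: contZ.
  by apply: eq_RI => t _; rewrite cReM.
rewrite -RID //; try exact: contZ.
by apply: eq_RI => t _; rewrite cImM.
Qed.

Lemma CI_sum (I : Type) (s : seq I) (f : I -> R -> R[i]) : (forall i, ccont (f i)) ->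
  CI (fun t => \sum_(i <- s) f i t) = \sum_(i <- s) CI (f i).
Proof.
move=> H; elim: s => [|i s IH].
  by rewrite big_nil; apply: eqcP; rewrite /CI /= (eq_RI (g := fun=> 0)) ?RI_cst ?mul0r // => t _;
    rewrite big_nil.
rewrite big_cons -IH -CID //; last exact: ccont_sum.
by congr CI; apply/funext => t; rewrite big_cons.
Qed.

Lemma CI_bound f g (E : R) : ccont f -> ccont g ->
  (forall t, 0 <= t <= tau -> normc (f t - g t) <= E) ->
  `|Re (CI f - CI g)| <= E * tau /\ `|Im (CI f - CI g)| <= E * tau.
Proof.
move=> [f1 f2] [g1 g2] H; rewrite cReB cImB /CI /= -!RIB //.
have contB (u v : R -> R) : cont_on u 0 tau -> cont_on v 0 tau -> cont_on (fun t => u t - v t) 0 tau.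
  by move=> hu hv t ht; apply: continuousB; [exact: hu|exact: hv].
split.
  have := @RI_bound _ (fun t => Re (f t) - Re (g t)) 0 E 0 tau tau0 (contB _ _ f1 g1).
  rewrite mul0r !subr0; apply => t ht; rewrite subr0 -cReB.
  exact: le_trans (Re_le_normc _) (H _ ht).
have := @RI_bound _ (fun t => Im (f t) - Im (g t)) 0 E 0 tau tau0 (contB _ _ f2 g2).
rewrite mul0r !subr0; apply => t ht; rewrite subr0 -cImB.
exact: le_trans (Im_le_normc _) (H _ ht).
Qed.

Let hE x0 y0 x y : (x +i* y) = (x0 +i* y0) + ((x - x0) +i* (y - y0)).
Proof. by apply: eqcP => /=; ring. Qed.

Let cdiff_box F D x0 y0 : cdiff F D (x0 +i* y0) ->
  forall e : R, 0 < e -> exists2 d : R, 0 < d & forall x y, `|x - x0| < d -> `|y - y0| < d ->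
    normc (F (x +i* y) - F (x0 +i* y0) - D * ((x - x0) +i* (y - y0)))
      <= e * (`|x - x0| + `|y - y0|).
Proof.
move=> hF e e0; have [d d0 hd] := hF e e0.
exists (d / 2); first by rewrite divr_gt0.
move=> x y hx hy; rewrite (hE x0 y0 x y).
have nh := normc_le ((x - x0) +i* (y - y0)).
apply: (le_trans (hd _ _)); first by apply: le_lt_trans nh _; rewrite /=; lra.
by rewrite ler_wpM2l // ltW.
Qed.

(** This is the form [Im (F dw)], with [dw = dx + i dy]. By the Cauchy-Riemann equations the
    derivative of [Im F] in [y] and that of [Re F] in [x] are both [Re D]. *)
Lemma cdiff_closed_form1 F D x0 y0 : cdiff F D (x0 +i* y0) ->
  closed_form_at (fun x y => Im (F (x +i* y))) (fun x y => Re (F (x +i* y))) x0 y0.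
Proof.
move=> hF; exists (Im D), (Re D), (- Im D) => e e0.
have [d d0 hd] := cdiff_box hF e0; exists d => // x y hx hy.
have H := hd x y hx hy.
split; apply: le_trans H.
  apply: le_trans (Im_le_normc _); rewrite !cImB cImM /= le_eqVlt; apply/orP; left.
  by apply/eqP; congr `|_|; ring.
apply: le_trans (Re_le_normc _); rewrite !cReB cReM /= le_eqVlt; apply/orP; left.
by apply/eqP; congr `|_|; ring.
Qed.

(** This is [- Re (F dw)]; the sign makes [Im F] the coefficient of [dy], as the second component of
    [CI] requires. *)
Lemma cdiff_closed_form2 F D x0 y0 : cdiff F D (x0 +i* y0) ->
  closed_form_at (fun x y => - Re (F (x +i* y))) (fun x y => Im (F (x +i* y))) x0 y0.
Proof.
move=> hF; exists (- Re D), (Im D), (Re D) => e e0.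
have [d d0 hd] := cdiff_box hF e0; exists d => // x y hx hy.
have H := hd x y hx hy.
split; apply: le_trans H.
  apply: le_trans (Re_le_normc _); rewrite -normrN !cReB cReM /= le_eqVlt; apply/orP; left.
  by apply/eqP; congr `|_|; ring.
apply: le_trans (Im_le_normc _); rewrite !cImB cImM /= le_eqVlt; apply/orP; left.
by apply/eqP; congr `|_|; ring.
Qed.

Lemma cdiff_ccont F x : (forall t, exists D, cdiff F D (x +i* t)) ->
  ccont (fun t => F (x +i* t)).
Proof.
move=> H; split=> t _; have [D hD] := H t.
  (* The rectangle is degenerate, reduced to the point [(x, t)], so differentiability is used at
     that point only. *)
  apply: (@closed_form_contr _ (fun x y => Im (F (x +i* y))) (fun x y => Re (F (x +i* y))) x t 0 0);
    rewrite ?addr0 ?lexx // => x0 y0 hx hy.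
  have -> : x0 = x by apply/eqP; rewrite eq_le andbC.
  have -> : y0 = t by apply/eqP; rewrite eq_le andbC.
  exact: cdiff_closed_form1 hD.
apply: (@closed_form_contr _ (fun x y => - Re (F (x +i* y))) (fun x y => Im (F (x +i* y))) x t 0 0);
  rewrite ?addr0 ?lexx // => x0 y0 hx hy.
have -> : x0 = x by apply/eqP; rewrite eq_le andbC.
have -> : y0 = t by apply/eqP; rewrite eq_le andbC.
exact: cdiff_closed_form2 hD.
Qed.

(** In [goursat] for the rectangle between [x] and [x'] of height one period, the two horizontal
    edges cancel by periodicity, which leaves the two vertical ones equal. *)
Lemma CI_periodic_const F x x' : x <= x' -> (forall w, Re w <= x' -> exists D, cdiff F D w) ->
  (forall w, F (w + (0 +i* tau)) = F w) ->
  CI (fun t => F (x +i* t)) = CI (fun t => F (x' +i* t)).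
Proof.
move=> xx' hF per.
have perE s : F (s +i* tau) = F (s +i* 0).
  by rewrite -[RHS]per; congr F; apply: eqcP => /=; ring.
have W0 : 0 <= x' - x by lra.
have xE : x + (x' - x) = x' by ring.
apply: eqcP; rewrite /CI /=.
  have := @goursat _ (fun x y => Im (F (x +i* y))) (fun x y => Re (F (x +i* y))) x 0 _ _ W0 tau0.
  rewrite xE !add0r => H; have {}H := H _; apply/eqP; rewrite -subr_eq0 -oppr_eq0 opprB; apply/eqP.
  rewrite -{}[RHS]H; last first.
    by move=> x0 y0 /andP[_ hx] _; have [D hD] := hF (x0 +i* y0) hx; exact: cdiff_closed_form1 hD.
  rewrite (eq_RI (f := fun s => Im (F (s +i* tau))) (g := fun s => Im (F (s +i* 0)))); first by ring.
  by move=> s _; rewrite perE.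
have := @goursat _ (fun x y => - Re (F (x +i* y))) (fun x y => Im (F (x +i* y))) x 0 _ _ W0 tau0.
rewrite xE !add0r => H; have {}H := H _; apply/eqP; rewrite -subr_eq0 -oppr_eq0 opprB; apply/eqP.
rewrite -{}[RHS]H; last first.
  by move=> x0 y0 /andP[_ hx] _; have [D hD] := hF (x0 +i* y0) hx; exact: cdiff_closed_form2 hD.
rewrite (eq_RI (f := fun s => - Re (F (s +i* tau))) (g := fun s => - Re (F (s +i* 0)))); first by ring.
by move=> s _; rewrite perE.
Qed.

(** Along a vertical line [F] has derivative [i G], so [Im F] and [- Re F] are primitives of [Re G]
    and [Im G]; both return to their initial value after a period. *)
Lemma CI_derive_periodic F G x : (forall w, cdiff F (G w) w) ->
  (forall w, F (w + (0 +i* tau)) = F w) -> ccont (fun t => G (x +i* t)) ->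
  CI (fun t => G (x +i* t)) = 0.
Proof.
move=> hF per [g1 g2].
have perE : F (x +i* tau) = F (x +i* 0).
  by rewrite -[RHS]per; congr F; apply: eqcP => /=; ring.
have box (t : R) (e : R) : 0 < e -> exists2 d : R, 0 < d & forall h : R, `|h| < d ->
    normc (F (x +i* (t + h)) - F (x +i* t) - G (x +i* t) * (0 +i* h)) <= e * `|h|.
  move=> e0; have [d d0 hd] := cdiff_box (hF (x +i* t)) e0; exists d => // h hh.
  have := hd x (t + h); rewrite subrr normr0 (addrC t h) addrK add0r; exact.
apply: eqcP; rewrite /CI /=.
  suff dI : forall t : R, is_derive t 1 (fun t => Im (F (x +i* t))) (Re (G (x +i* t))).
    by rewrite (RI_derive tau_gt0 dI g1) perE subrr.
  move=> t; apply: expansion_is_derive => e e0; have [d d0 hd] := box t e e0; exists d => // h /hd.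
  apply: le_trans; apply: le_trans (Im_le_normc _); rewrite !cImB cImM /= le_eqVlt; apply/orP; left.
  by apply/eqP; congr `|_|; ring.
suff dR : forall t : R, is_derive t 1 (fun t => - Re (F (x +i* t))) (Im (G (x +i* t))).
  by rewrite (RI_derive tau_gt0 dR g2) perE subrr.
move=> t; apply: expansion_is_derive => e e0; have [d d0 hd] := box t e e0; exists d => // h /hd.
apply: le_trans; apply: le_trans (Re_le_normc _); rewrite -normrN !cReB cReM /= le_eqVlt; apply/orP; left.
by apply/eqP; congr `|_|; ring.
Qed.

End circle_means.

(** * Taylor coefficients of the exponential as circle means *)

Section exponential_coefficients.
Variable R : realType.
Implicit Types (z w h L : R[i]) (x t : R).
Local Notation tau := (pi *+ 2 : R).

Let tau_gt0 : 0 < tau. Proof. by rewrite pmulrn_lgt0 // pi_gt0. Qed.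

(** The integrand that extracts the [k]-th Taylor coefficient at 0 of [exp (L z)], on the circle
    [z = cE w]. A term of a Dirichlet series about a centre [c] has this form with [L = - ln n]. *)
Definition Psi L k w : R[i] := cE (L * cE w) * cE (- w) ^+ k.

Lemma cEN_periodic w : cE (- (w + (0 +i* tau))) = cE (- w).
Proof. by rewrite -[LHS]cE_periodic opprD addrNK. Qed.

Lemma Psi_periodic L k w : Psi L k (w + (0 +i* tau)) = Psi L k w.
Proof. by rewrite /Psi cE_periodic cEN_periodic. Qed.

Lemma cdiff_cEN w : cdiff (fun w => cE (- w)) (- cE (- w)) w.
Proof.
have hN : cdiff (fun w => -1 * w) (0 * w + -1 * 1) w.
  by apply: (cdiffM (cdiff_cst _ _) (cdiff_id _)).
under [X in cdiff X]eq_fun do rewrite -mulN1r.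
by apply: eq_cdiff (cdiff_comp hN (cdiff_cE _)) _; rewrite mulN1r; ring.
Qed.

Lemma cdiff_cEL L w : cdiff (fun w => cE (L * cE w)) (cE (L * cE w) * (L * cE w)) w.
Proof.
have hL : cdiff (fun w => L * cE w) (0 * cE w + L * cE w) w.
  by apply: (cdiffM (cdiff_cst _ _) (cdiff_cE _)).
by apply: eq_cdiff (cdiff_comp hL (cdiff_cE _)) _; ring.
Qed.

Lemma cdiff_Psi L k w :
  cdiff (Psi L k) (cE (L * cE w) * (L * cE w) * cE (- w) ^+ k
    + cE (L * cE w) * (k%:R * cE (- w) ^+ k.-1 * - cE (- w))) w.
Proof. exact: (cdiffM (cdiff_cEL _ _) (cdiffX _ (cdiff_cEN _))). Qed.

Lemma ccont_Psi L k x : ccont (fun t => Psi L k (x +i* t)).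
Proof. by apply: cdiff_ccont => t; eexists; exact: cdiff_Psi. Qed.

Lemma cdiff_PsiS L k w : cdiff (Psi L k.+1) (L * Psi L k w + - k.+1%:R * Psi L k.+1 w) w.
Proof.
apply: eq_cdiff (cdiff_Psi _ _ _) _.
(* One factor [cE (- w)] cancels the [cE w] created by the chain rule, which lowers [k.+1] to
   [k]. *)
have E : cE w * cE (- w) = 1 by rewrite -cED subrr cE0.
rewrite /Psi /= exprS.
have -> : cE (L * cE w) * (L * cE w) * (cE (- w) * cE (- w) ^+ k) =
  L * (cE (L * cE w) * cE (- w) ^+ k) * (cE w * cE (- w)) by ring.
by rewrite E; ring.
Qed.

(** The integral does not depend on [x]. Far to the left, [L * cE w] is so small that the integrand
    is uniformly close to 1. *)
Lemma CI_Psi0 L x : CI (fun t => Psi L 0 (x +i* t)) = tau%:C.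
Proof.
have [d d0 hd] := cdiff_lip (@cdiff_cE0 R).
have near1 (e : R) : 0 < e -> `|Re (CI (fun t => Psi L 0 (x +i* t)) - tau%:C)| <= e * tau /\
    `|Im (CI (fun t => Psi L 0 (x +i* t)) - tau%:C)| <= e * tau.
  move=> e0; pose K := normc L + 1.
  have K0 : 0 < K by rewrite ltr_wpDl // normc_ge0.
  have [m [m0 md me]] : exists m : R, [/\ 0 < m, m <= d / 2 & m <= e / 2].
    by exists (Num.min (d / 2) (e / 2)); split; rewrite ?ge_min ?lexx ?orbT // lt_min !divr_gt0.
  pose x' := Num.min x (ln (m / K)).
  rewrite -(@CI_periodic_const _ (Psi L 0) x' x); first last.
  - exact: Psi_periodic.
  - by move=> w _; eexists; exact: cdiff_Psi.
  - by rewrite ge_min lexx.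
  have -> : tau%:C = CI (fun=> 1).
    by apply: eqcP; rewrite /CI /= RI_cst ?subr0 ?mul1r ?mul0r // ltW.
  apply: CI_bound; [exact: ccont_Psi|exact: ccont_cst|move=> t _].
  rewrite /Psi expr0 mulr1.
  have nL : normc (L * cE (x' +i* t)) <= m.
    rewrite normcM normc_cE /=.
    have : expR x' <= m / K.
      rewrite -[leRHS]lnK ?posrE ?divr_gt0 // ler_expR ge_min lexx orbT //.
    rewrite ler_pdivlMr // => H; have := expR_gt0 x'; rewrite /K in H; have := normc_ge0 L; nra.
  have := hd (L * cE (x' +i* t)); rewrite add0r cE0 normc1 => H.
  by apply: le_trans (H _) _; lra.
have zero (u : R) : (forall e : R, 0 < e -> `|u| <= e * tau) -> u = 0.
  move=> hu; apply/normr0_eq0/eqP; rewrite eq_le normr_ge0 andbT.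
  apply/ler_addgt0Pr => e e0; rewrite add0r.
  by have := hu (e / tau); rewrite divfK ?gt_eqF // divr_gt0 //; exact.
apply/eqP; rewrite -subr_eq0; apply/eqP; apply: eqcP => /=; apply: zero => e e0;
  by have [] := near1 e e0.
Qed.

(* Integrating the derivative of [Psi L k.+1] over a period gives
   [L * T_k = (k+1) * T_(k+1)]. *)
Lemma CI_Psi L k x : CI (fun t => Psi L k (x +i* t)) = tau%:C * (L ^+ k / k`!%:R).
Proof.
elim: k => [|k IH]; first by rewrite CI_Psi0 expr0 fact0 divr1 mulr1.
have C k' := ccont_Psi L k' x.
have := CI_derive_periodic (cdiff_PsiS L k) (Psi_periodic L k.+1)
  (ccontD (ccontZ L (C k)) (ccontZ (- k.+1%:R) (C k.+1))).
rewrite CID; [|exact: ccontZ|exact: ccontZ].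
rewrite !CIZ // IH => H.
have k0 : k.+1%:R != 0 :> R[i] by rewrite pnatr_eq0.
have f0 : k`!%:R != 0 :> R[i] by rewrite pnatr_eq0 -lt0n fact_gt0.
apply: (mulfI k0); apply/eqP; rewrite -subr_eq0 -oppr_eq0 opprB; apply/eqP.
rewrite -{}[RHS]H factS natrM exprS.
by move: k0 f0 (L ^+ k); move: (k.+1%:R : R[i]) (k`!%:R : R[i]) => u v u0 v0 l; field; rewrite u0 v0.
Qed.

End exponential_coefficients.

(** * Dirichlet series *)

Section abel_summation.
Variable R : realType.
Implicit Types (z w h s : R[i]) (x t u : R) (a : nat -> R).

Lemma normr_sin_le u : `|sin u| <= `|u|.
Proof.
wlog u0 : u / 0 <= u => [H|].
  have [/H//|/ltW u0] := leP 0 u.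
  by rewrite -normrN -sinN -(normrN u); apply: H; rewrite oppr_ge0.
have [|c _] := @MVT_segment R sin cos 0 u u0 (fun x _ => is_derive_sin x).
  by apply: continuous_subspaceT => x; exact: continuous_sin.
rewrite sin0 !subr0 => ->; rewrite normrM ler_piMl //; exact: cos_max.
Qed.

Lemma normr_1Bcos_le u : `|1 - cos u| <= `|u|.
Proof.
have -> : u = (u / 2) *+ 2 by rewrite mulr2n; field.
rewrite cos_mulr2n cos2sin2.
have -> : 1 - ((1 - sin (u / 2) ^+ 2) *+ 2 - 1) = sin (u / 2) * sin (u / 2) *+ 2.
  by rewrite -expr2; ring.
rewrite !normrMn lerMn2r /= normrM; apply: le_trans (normr_sin_le _).
by rewrite ler_piMl //; exact: sin_max.
Qed.

Lemma normc_1BcE_im u : normc (1 - cE (0 +i* u)) <= 2 * `|u|.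
Proof.
apply: le_trans (normc_le _) _; rewrite /cE /= expR0 !mul1r sub0r normrN.
by have := normr_sin_le u; have := normr_1Bcos_le u; lra.
Qed.

(** Equal to [npow_opp n w] at [l = ln n]. A free real [l] allows differences of logarithms as
    exponents, as in [vpow_decr]. *)
Definition vpow w (l : R) : R[i] := cE (- (w * l%:C)).

Lemma normc_vpow w l : normc (vpow w l) = expR (- (Re w * l)).
Proof. by rewrite normc_cE; case: w => p q /=; rewrite mulr0 subr0. Qed.

(** The right-hand side telescopes over consecutive integers, as Abel summation needs. After
    factoring out [vpow w l], the phase costs at most [2 |Im w| k E] with [E = exp (- Re w k)], and
    [exp x >= 1 + x] gives [E * (Re w k) <= 1 - E]. *)
Lemma vpow_decr w l l' : 0 < Re w -> l <= l' ->
  normc (vpow w l - vpow w l') <=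
    (1 + 2 * `|Im w| / Re w) * (normc (vpow w l) - normc (vpow w l')).
Proof.
move=> w0 ll'; pose k := l' - l; have k0 : 0 <= k by rewrite subr_ge0.
have vE : vpow w l' = vpow w l * vpow w k.
  rewrite /vpow -cED; congr cE; rewrite /k.
  by apply: eqcP; case: w {w0} => p q /=; ring.
have -> : vpow w l - vpow w l' = vpow w l * (1 - vpow w k) by rewrite vE; ring.
rewrite vE !normcM.
have -> : normc (vpow w l) - normc (vpow w l) * normc (vpow w k) =
  normc (vpow w l) * (1 - normc (vpow w k)) by ring.
rewrite mulrCA ler_wpM2l ?normc_ge0 //.
have kE : vpow w k = (expR (- (Re w * k)))%:C * cE (0 +i* (- (Im w * k))).
  have wkE : - (w * k%:C) = (- (Re w * k)) +i* (- (Im w * k)).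
    by apply: eqcP; case: w {w0 vE} => p q /=; ring.
  by rewrite /vpow wkE; apply: eqcP; rewrite /cE /= expR0; ring.
rewrite normc_vpow kE; set E := expR _.
have E0 : 0 <= E by exact: expR_ge0.
have E1 : E <= 1 by rewrite expR_le1 oppr_le0 mulr_ge0 // ltW.
have -> : 1 - E%:C * cE (0 +i* - (Im w * k)) = (1 - E)%:C + E%:C * (1 - cE (0 +i* - (Im w * k))).
  by rewrite rmorphB; ring.
apply: le_trans (le_normcD _ _) _; rewrite normcM !normc_real (ger0_norm E0) (@ger0_norm _ (1 - E)) ?subr_ge0 //.
rewrite mulrDl mul1r lerD2l.
apply: (@le_trans _ _ (E * (2 * `|- (Im w * k)|))); first by rewrite ler_wpM2l // normc_1BcE_im.
rewrite normrN normrM (ger0_norm k0).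
have kx : E * (Re w * k) <= 1 - E.
  have := expR_ge1Dx (Re w * k); have : E * expR (Re w * k) = 1.
    by rewrite /E mulrC expRxMexpNx_1.
  move: E0; nra.
have -> : E * (2 * (`|Im w| * k)) = (2 * `|Im w| / Re w) * (E * (Re w * k)).
  by field; rewrite gt_eqF.
by rewrite ler_wpM2l // divr_ge0 ?mulr_ge0 // ltW.
Qed.

Definition dpart a s N : R[i] := \sum_(1 <= n < N.+1) (a n)%:C * vpow s (ln n%:R).

Lemma dpartS a s N : dpart a s N.+1 = dpart a s N + (a N.+1)%:C * vpow s (ln N.+1%:R).
Proof. by rewrite /dpart big_nat_recr. Qed.

Lemma ln_nat_homo n m : (0 < n)%N -> (n <= m)%N -> ln n%:R <= ln m%:R :> R.
Proof.
move=> n0 nm; rewrite ler_ln ?posrE ?ltr0n // ?ler_nat //; exact: leq_trans nm.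
Qed.

Lemma abel_bound a s1 s (B : R) : (forall N, normc (dpart a s1 N) <= B) ->
  0 < Re (s - s1) -> forall N M, (0 < N)%N -> (N <= M)%N ->
  normc (dpart a s M - dpart a s N) <=
    B * (3 + 2 * `|Im (s - s1)| / Re (s - s1)) * expR (- (Re (s - s1) * ln N%:R)).
Proof.
move=> hB; set w := s - s1 => w0 N M N0 NM.
pose v n := vpow w (ln n%:R).
set K := 2 * `|Im w| / Re w.
have K0 : 0 <= K by rewrite divr_ge0 ?mulr_ge0 // ltW.
have B0 : 0 <= B by apply: le_trans (hB 0%N); exact: normc_ge0.
have sE n : vpow s (ln n%:R) = vpow s1 (ln n%:R) * v n.
  by rewrite /v /vpow -cED; congr cE; rewrite /w; ring.
(* The left-hand side is what summation by parts leaves without its boundary terms: the sum of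
   [dpart a s1 n * (v n - v n.+1)] for [N <= n < M']. The two boundary terms, each at most
   [B * normc (v N)], turn [1 + K] into [3 + K] at the end. *)
have step M' : (N <= M')%N ->
    normc (dpart a s M' - dpart a s N - dpart a s1 M' * v M' + dpart a s1 N * v N)
    <= B * (1 + K) * (normc (v N) - normc (v M')).
  elim: M' => [|M' IH] NM'.
    by move: N0; rewrite leqNgt ltnS NM'.
  move: NM'; rewrite leq_eqVlt => /predU1P[<-|NM'].
    by rewrite !subrr sub0r addNr normc0 mulr0.
  have {}IH := IH NM'.
  rewrite !dpartS sE.
  set SM := dpart a s M'; set SN := dpart a s N; set T := dpart a s1 M'; set TN := dpart a s1 N.
  set c := (a _)%:C.
  have -> : SM + c * (vpow s1 (ln M'.+1%:R) * v M'.+1) - SN -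
    (T + c * vpow s1 (ln M'.+1%:R)) * v M'.+1 + TN * v N =
    (SM - SN - T * v M' + TN * v N) + T * (v M' - v M'.+1) by ring.
  apply: le_trans (le_normcD _ _) _; rewrite normcM.
  have H : normc T * normc (v M' - v M'.+1) <= B * ((1 + K) * (normc (v M') - normc (v M'.+1))).
    apply: ler_pM; rewrite ?normc_ge0 //; first exact: hB.
    apply: vpow_decr => //; apply: ln_nat_homo => //; exact: leq_trans N0 NM'.
  apply: le_trans (lerD IH H) _.
  by rewrite le_eqVlt; apply/orP; left; apply/eqP; ring.
have H := step M NM.
have vM : normc (v M) <= normc (v N).
  by rewrite !normc_vpow ler_expR lerN2 ler_pM2l //; exact: ln_nat_homo.
have -> : dpart a s M - dpart a s N =
   (dpart a s M - dpart a s N - dpart a s1 M * v M + dpart a s1 N * v N)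
    + (dpart a s1 M * v M + - (dpart a s1 N * v N)) by ring.
apply: le_trans (le_normcD _ _) _.
have A2 := le_normcD (dpart a s1 M * v M) (- (dpart a s1 N * v N)).
rewrite normcN !normcM in A2.
have A3 : normc (dpart a s1 M) * normc (v M) <= B * normc (v N).
  by apply: ler_pM; rewrite ?normc_ge0.
have A4 : normc (dpart a s1 N) * normc (v N) <= B * normc (v N).
  by apply: ler_pM; rewrite ?normc_ge0.
have -> : expR (- (Re w * ln N%:R)) = normc (v N) by rewrite normc_vpow.
have B1K : 0 <= B * (1 + K) * normc (v M) by rewrite !mulr_ge0 ?normc_ge0 // addr_ge0.
have := normc_ge0 (v N); have := normc_ge0 (v M).
nra.
Qed.

Lemma complex_cauchy_cvg (u : nat -> R[i]) :
  (forall e : R, 0 < e -> exists N, forall n m, (N <= n)%N -> (n <= m)%N -> normc (u m - u n) <= e) ->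
  exists l, forall e : R, 0 < e -> exists N, forall n, (N <= n)%N -> normc (u n - l) <= e.
Proof.
move=> H.
have real (p : nat -> R) : (forall e : R, 0 < e -> exists N, forall n m, (N <= n)%N -> (n <= m)%N -> `|p m - p n| <= e) ->
   exists l : R, forall e : R, 0 < e -> exists N, forall n, (N <= n)%N -> `|p n - l| <= e.
  move=> Hp; have /cvg_ex[l hl] : cvgn p.
    apply/cauchy_cvgP/cauchy_exP => e e0.
    have e2 : 0 < e / 2 by rewrite divr_gt0.
    have [N hN] := Hp _ e2; exists (p N), N => // n /= Nn.
    by rewrite /ball /= distrC; apply: le_lt_trans (hN _ _ (leqnn N) Nn) _; lra.
  exists l => e e0; have /cvgrPdist_le/(_ e e0)[N _ hN] := hl.
  by exists N => n Nn; rewrite distrC; exact: hN.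
have [lr hlr] : exists l : R, forall e : R, 0 < e -> exists N, forall n, (N <= n)%N -> `|Re (u n) - l| <= e.
  apply: real => e e0; have [N hN] := H e e0; exists N => n m Nn nm.
  by rewrite -cReB; apply: le_trans (Re_le_normc _) (hN _ _ Nn nm).
have [li hli] : exists l : R, forall e : R, 0 < e -> exists N, forall n, (N <= n)%N -> `|Im (u n) - l| <= e.
  apply: real => e e0; have [N hN] := H e e0; exists N => n m Nn nm.
  by rewrite -cImB; apply: le_trans (Im_le_normc _) (hN _ _ Nn nm).
exists (lr +i* li) => e e0; have e2 : 0 < e / 2 by rewrite divr_gt0.
have [N hN] := hlr _ e2; have [N' hN'] := hli _ e2.
exists (maxn N N') => n; rewrite geq_max => /andP[/hN A /hN' B].
by apply: le_trans (normc_le _) _; rewrite cReB cImB /=; lra.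
Qed.

Lemma cplx_cvgP (u : nat -> cplx R) (l : cplx R) : u @ \oo --> l <->
  forall e : R, 0 < e -> exists N, forall n, (N <= n)%N -> normc ((u n : R[i]) - (l : R[i])) <= e.
Proof.
split=> [/cvgrPdist_le H e e0|H].
  have e0' : (0 : cplx R) < (e%:C : R[i]) by rewrite /cplx /= ltcR.
  have [N _ hN] := H _ e0'; exists N => n Nn.
  have := hN n Nn; rewrite distrC.
  by change (((normc ((u n : R[i]) - (l : R[i])))%:C <= e%:C :> R[i]) -> normc ((u n : R[i]) - (l : R[i])) <= e); rewrite lecR.
apply/cvgrPdist_le => e e0.
have [Ie Re0] : Im (e : R[i]) = 0 /\ 0 < Re (e : R[i]).
  by move: e0; rewrite ltcE /= => /andP[/eqP].
have eE : e = ((Re (e : R[i]))%:C : R[i]) by move: Ie; case: (e : R[i]) => a b /= ->.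
have [N hN] := H _ Re0; exists N => // n Nn; rewrite distrC eE.
by change ((normc ((u n : R[i]) - (l : R[i])))%:C <= (Re (e : R[i]))%:C :> R[i]); rewrite lecR; exact: hN.
Qed.

Lemma abscissa_lt_bounded a (sigma x : R) : (abscissa_cvg a <= sigma%:E)%E -> sigma < x ->
  exists2 s1, Re s1 < x & exists B, forall N, normc (dpart a s1 N) <= B.
Proof.
move=> hs sx.
have /ereal_inf_lt[_ [s1 /= hcv <-] s1x] : (abscissa_cvg a < x%:E)%E.
  by apply: le_lt_trans hs _; rewrite lte_fin.
exists s1; first by rewrite -lte_fin.
have /cvg_ex[l hl] := hcv; have [N hN] := (cplx_cvgP _ _).1 hl 1 ltr01.
pose f n := normc (dpart a s1 n).
exists (normc (l : R[i]) + 1 + \sum_(n < N) f n) => n.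
have S0 : 0 <= \sum_(n < N) f n by apply: sumr_ge0 => i _; exact: normc_ge0.
have [Nn|nN] := leqP N n.
  have -> : dpart a s1 n = (dpart a s1 n - (l : R[i])) + (l : R[i]) by ring.
  apply: le_trans (le_normcD _ _) _.
  by have := hN n Nn; rewrite -[dirichlet_partial a s1 n]/(dpart a s1 n); lra.
rewrite (bigD1 (Ordinal nN)) //= -/(f n).
have : 0 <= \sum_(i < N | i != Ordinal nN) f i by apply: sumr_ge0 => i _; exact: normc_ge0.
by have := normc_ge0 (l : R[i]); lra.
Qed.

(** Partial sums are bounded at some [s1] with [Re s1 < sigma + eta / 2]. Every [s] considered is
    then at least [eta / 2] further right, and [abel_bound] yields one tail estimate
    [K N ^ (- eta / 2)] for all of them. *)
Lemma dirichlet_unif_cvg a (sigma eta T : R) : (abscissa_cvg a <= sigma%:E)%E -> 0 < eta ->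
  forall e : R, 0 < e -> exists N0, forall N s, (N0 <= N)%N -> sigma + eta <= Re s ->
    `|Im s| <= T -> normc (dpart a s N - (dirichlet_sum a s : R[i])) <= e.
Proof.
move=> hs eta0.
have [|s1 s1x [B hB]] := @abscissa_lt_bounded a sigma (sigma + eta / 2) hs; first by lra.
have B0 : 0 <= B by apply: le_trans (hB 0%N); exact: normc_ge0.
pose x0 := eta / 2; have x00 : 0 < x0 by rewrite divr_gt0.
pose K := B * (3 + 2 * (`|T| + `|Im s1|) / x0).
have K0 : 0 <= K by rewrite mulr_ge0 // addr_ge0 // divr_ge0 // ?mulr_ge0 ?addr_ge0 // ltW.
have cau s N M : sigma + eta <= Re s -> `|Im s| <= T -> (0 < N)%N -> (N <= M)%N ->
    normc (dpart a s M - dpart a s N) <= K * expR (- (x0 * ln N%:R)).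
  move=> hr hi N0 NM.
  have w0 : x0 <= Re (s - s1) by rewrite cReB /x0; lra.
  apply: le_trans (abel_bound hB (lt_le_trans x00 w0) N0 NM) _.
  have lnN : 0 <= ln N%:R :> R by rewrite ln_ge0 // ler1n.
  apply: ler_pM; rewrite ?expR_ge0 //.
  - rewrite mulr_ge0 // addr_ge0 // divr_ge0 ?mulr_ge0 // ltW //; exact: lt_le_trans w0.
  - rewrite ler_wpM2l // lerD2l; apply: ler_pM.
    + by rewrite mulr_ge0.
    + by rewrite invr_ge0 ltW // (lt_le_trans x00).
    + rewrite ler_pM2l // cImB; apply: le_trans (ler_normB _ _) _.
      by rewrite lerD2r; apply: le_trans hi _; exact: ler_norm.
    + by rewrite lef_pV2 // posrE // (lt_le_trans x00).
  - by rewrite ler_expR lerN2 ler_wpM2r.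
have small (e : R) : 0 < e -> exists2 N0, (0 < N0)%N & forall N, (N0 <= N)%N -> K * expR (- (x0 * ln N%:R)) <= e.
  move=> e0; pose q := (K + 1) / e.
  have q0 : 0 < q by rewrite divr_gt0 // ltr_wpDl.
  (* Beyond [N0] the power [N ^ x0] is at least [q = (K + 1) / e], so the tail estimate is at most
     [K / q <= e]. *)
  pose N0 := (Num.bound (expR (ln q / x0))).+1.
  exists N0 => // N NN.
  have lq : ln q <= x0 * ln N%:R.
    rewrite mulrC -ler_pdivrMr // -[leLHS]expRK ler_ln ?posrE ?expR_gt0 ?ltr0n ?(leq_trans _ NN) //.
    apply: (@le_trans _ _ N0%:R); last by rewrite ler_nat.
    apply: ltW; apply: lt_le_trans (archi_boundP (expR_ge0 _)) _; by rewrite ler_nat.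
  apply: (@le_trans _ _ (K * expR (- ln q))).
    by rewrite ler_wpM2l // ler_expR lerN2.
  rewrite expRN lnK ?posrE // /q invf_div mulrCA -[leRHS]mulr1 ler_pM2l // ler_pdivrMr; lra.
move=> e e0; have e2 : 0 < e / 2 by rewrite divr_gt0.
have [N0 N00 hN0] := small _ e2; exists N0 => N s N0N hr hi.
have [l hl] : exists l, forall e : R, 0 < e -> exists N, forall n, (N <= n)%N -> normc (dpart a s n - l) <= e.
  apply: complex_cauchy_cvg => e' e'0; have [N1 N10 hN1] := small _ e'0.
  exists N1 => n m Nn nm; apply: le_trans (cau s n m hr hi (leq_trans N10 Nn) nm) _; exact: hN1.
have cl : dirichlet_partial a s @ \oo --> (l : cplx R) by apply/cplx_cvgP.
have -> : (dirichlet_sum a s : R[i]) = l := cvg_lim (@norm_hausdorff _ _) cl.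
have [N1 hN1] := hl _ e2.
have A := hN1 _ (leq_maxl N1 N); have B' := cau s N (maxn N1 N) hr hi (leq_trans N00 N0N) (leq_maxr _ _).
have {}B' := le_trans B' (hN0 _ N0N).
have -> : dpart a s N - l = (dpart a s (maxn N1 N) - l) - (dpart a s (maxn N1 N) - dpart a s N) by ring.
apply: le_trans (le_normcD _ _) _; rewrite normcN; lra.
Qed.

End abel_summation.

(** * Cauchy estimates for a continued Dirichlet series *)

Section continuation.
Variable R : realType.
Implicit Types (z w h s : R[i]) (x t u : R) (a : nat -> R).
Local Notation tau := (pi *+ 2 : R).

Lemma cont_on_bounded (f : R -> R) (p q : R) : cont_on f p q ->
  exists M : R, forall x, p <= x <= q -> `|f x| <= M.
Proof.
move=> cf; have [M [_ hM]] := compact_bounded (continuous_compact (cont_on_within cf) (@segment_compact _ p q)).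
exists (M + 1) => x hx; apply: (hM (M + 1)); first by rewrite ltrDl.
by exists x.
Qed.

Lemma abscissa_le_of_cauchy a x :
  (forall e : R, 0 < e -> exists N, forall n m, (N <= n)%N -> (n <= m)%N ->
    `|\sum_(1 <= i < m.+1) a i * expR (- (x * ln i%:R)) -
      \sum_(1 <= i < n.+1) a i * expR (- (x * ln i%:R))| <= e) ->
  (abscissa_cvg a <= x%:E)%E.
Proof.
move=> H; apply: ereal_inf_lbound; exists x%:C => //.
have E n : dpart a x%:C n = (\sum_(1 <= i < n.+1) a i * expR (- (x * ln i%:R)))%:C.
  rewrite /dpart rmorph_sum /=; apply: eq_bigr => i _; rewrite rmorphM; congr (_ * _).
  rewrite /vpow -rmorphM -rmorphN /cE /= cos0 sin0 mulr1 mulr0.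
  by [].
have [l hl] : exists l, forall e : R, 0 < e -> exists N, forall n, (N <= n)%N -> normc (dpart a x%:C n - l) <= e.
  apply: complex_cauchy_cvg => e e0; have [N hN] := H e e0; exists N => n m Nn nm.
  by rewrite !E -rmorphB normc_real; exact: hN.
by apply/cvg_ex; exists l; apply/cplx_cvgP.
Qed.

Let small_term x t (l : R) k : cE (- ((x +i* t) * l%:C)) * ((- l)%:C ^+ k / k`!%:R) =
  ((-1) ^+ k)%:C * ((expR (- (x * l)) * cos (t * l) * l ^+ k / k`!%:R) +i*
     (- (expR (- (x * l)) * sin (t * l) * l ^+ k / k`!%:R))).
Proof.
have -> : - ((x +i* t) * l%:C) = (- (x * l)) +i* (- (t * l)) by apply: eqcP => /=; ring.
have -> : (- l)%:C ^+ k / k`!%:R = ((-1) ^+ k * (l ^+ k / k`!%:R))%:C.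
  by rewrite -(rmorph_nat (real_complex R)) -rmorphXn -fmorphV -rmorphM /= (exprNn l) mulrA.
by rewrite /cE /= cosN sinN; apply: eqcP => /=; ring.
Qed.

(** The [k]-th circle mean of the continuation is the same on the circles of radius [eta / 2] and
    [2 * eta]. On the large one it is bounded by Cauchy's estimate; on the small one it is
    approximated by the mean of a partial sum, whose real and imaginary parts are, up to sign and
    the factor [2 pi], the two sums stated. *)
Lemma dirichlet_continuation_bound a (sigma : R) s0 :
  abscissa_cvg a = sigma%:E -> Re s0 = sigma ->
  continuable_at sigma (dirichlet_sum a) s0 ->
  exists (j : nat) (t : rat) (C : nat), let eta := j.+1%:R^-1 : R in
  forall k, exists N0, forall N, (N0 <= N)%N ->
    `|\sum_(1 <= n < N.+1) a n * (expR (- ((sigma + eta) * ln n%:R)) *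
        cos (ratr t * ln n%:R) * ln n%:R ^+ k / k`!%:R)| <= C%:R / (2 * eta) ^+ k /\
    `|\sum_(1 <= n < N.+1) a n * (expR (- ((sigma + eta) * ln n%:R)) *
        sin (ratr t * ln n%:R) * ln n%:R ^+ k / k`!%:R)| <= C%:R / (2 * eta) ^+ k.
Proof.
move=> hs s0s [U [g [oU Us0 hol gF]]].
have pi0 : 0 < tau by rewrite pmulrn_lgt0 // pi_gt0.
have [d d0 hd] : exists2 d : R, 0 < d & forall z, normc (z - s0) < d -> U z.
  have /nbhs_ballP[d /= d0 hd] : nbhs (s0 : cplx R) U by apply: open_nbhs_nbhs.
  have [Id Rd] : Im (d : R[i]) = 0 /\ 0 < Re (d : R[i]).
    by move: d0; rewrite ltcE /= => /andP[/eqP].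
  have dE : d = ((Re (d : R[i]))%:C : R[i]) by move: Id; case: (d : R[i]) => p q /= ->.
  exists (Re (d : R[i])) => // z hz; apply: hd; rewrite /ball /= distrC dE.
  by change ((normc (z - s0))%:C < (Re (d : R[i]))%:C :> R[i]); rewrite ltcR.
(* The closed disc of radius [2 * eta] about [c] has to lie within [d] of [s0]: [c] is at most
   [2 * eta] away from [s0], so [4 * eta < d] is enough. *)
pose j := Num.bound (5 / d).
pose eta : R := j.+1%:R^-1.
have eta0 : 0 < eta by rewrite invr_gt0 ltr0n.
have eta_d : 5 * eta < d.
  rewrite /eta ltr_pdivrMr ?ltr0n // mulrC -ltr_pdivrMr //.
  apply: lt_trans (archi_boundP _) _; first by rewrite divr_ge0 // ltW.
  by rewrite ltr_nat.
have t_itv : Im s0 - eta < Im s0 + eta by lra.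
(* A rational height for the centre keeps the set of possible parameters countable. *)
have [t] := rat_in_itvoo t_itv; rewrite in_itv /= => /andP[t1 t2].
set tr : R := ratr t in t1 t2.
pose c := (sigma + eta) +i* tr.
have cU z : normc (z - c) <= 2 * eta -> U z.
  move=> hz; apply: hd.
  have -> : z - s0 = (z - c) + (c - s0) by ring.
  apply: le_lt_trans (le_normcD _ _) _.
  have := normc_le (c - s0); rewrite cReB cImB /= s0s.
  have -> : sigma + eta - sigma = eta by ring.
  rewrite (ger0_norm (ltW eta0)).
  have : `|tr - Im s0| <= eta by rewrite ler_norml; lra.
  lra.
have gdiff z : normc (z - c) <= 2 * eta -> exists D, cdiff (g : R[i] -> R[i]) D z.
  by move=> /cU /hol; exact: cdiff_derivable.
(* The outer circle [Re w = X] crosses the line [Re s = sigma]; the inner one [Re w = x] stays in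
   [Re s >= sigma + eta / 2], where the series converges uniformly. *)
pose X := ln (2 * eta); pose x := ln (eta / 2).
have eX : expR X = 2 * eta by rewrite lnK // posrE mulr_gt0.
have ex : expR x = eta / 2 by rewrite lnK // posrE divr_gt0.
have xX : x <= X by rewrite -ler_expR eX ex; lra.
pose Phi k w : R[i] := (g (c + cE w) : R[i]) * cE (- w) ^+ k.
have disc w : Re w <= X -> normc (c + cE w - c) <= 2 * eta.
  by move=> wX; rewrite addrAC subrr add0r normc_cE -eX ler_expR.
have Phi_diff k w : Re w <= X -> exists D, cdiff (Phi k) D w.
  move=> wX; have [D hD] := gdiff _ (disc w wX); eexists.
  apply: cdiffM (cdiffX _ (cdiff_cEN _)).
  exact: (cdiff_comp (cdiffD (cdiff_cst c w) (cdiff_cE w)) hD).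
have Phi_per k w : Phi k (w + (0 +i* tau)) = Phi k w.
  by rewrite /Phi cE_periodic cEN_periodic.
have Phi_cont k y : y <= X -> ccont (fun t => Phi k (y +i* t)).
  by move=> yX; apply: cdiff_ccont => t'; exact: Phi_diff.
have PhiE k : CI (fun t => Phi k (x +i* t)) = CI (fun t => Phi k (X +i* t)).
  by apply: CI_periodic_const => // w; exact: Phi_diff.
have [M hM] : exists M : R, forall t', 0 <= t' <= tau -> normc (Phi 0 (X +i* t')) <= M.
  have [A B] := Phi_cont 0 X (lexx _).
  have [MA hMA] := cont_on_bounded A; have [MB hMB] := cont_on_bounded B.
  exists (MA + MB) => t' ht'; apply: le_trans (normc_le _) _.
  by apply: lerD; [exact: hMA|exact: hMB].
pose C := Num.bound (`|M| + 1).
exists j, t, C => /=; rewrite -/eta -/tr => k.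
have p0 : 0 < (2 * eta) ^+ k by rewrite exprn_gt0 // mulr_gt0.
have q0 : 0 < (eta / 2) ^+ k by rewrite exprn_gt0 // divr_gt0.
(* On the inner circle errors are multiplied by [(eta / 2) ^- k]; this tolerance turns them into
   [(2 * eta) ^- k], which is the 1 added to [|M|] in [C]. *)
pose e := (eta / 2) ^+ k / (2 * eta) ^+ k.
have e0 : 0 < e by rewrite divr_gt0.
have eta2 : 0 < eta / 2 by rewrite divr_gt0.
have hs' : (abscissa_cvg a <= sigma%:E)%E by rewrite hs.
have [N0 hN0] := @dirichlet_unif_cvg R a sigma (eta / 2) (`|tr| + eta) hs' eta2 e e0.
exists N0 => N NN.
pose f n t' : R[i] := ((a n)%:C * vpow c (ln n%:R)) * Psi (- ln n%:R)%:C k (x +i* t').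
have f_cont n : ccont (f n) by apply: ccontZ; exact: ccont_Psi.
have fE t' : \sum_(1 <= n < N.+1) f n t' = dpart a (c + cE (x +i* t')) N * cE (- (x +i* t')) ^+ k.
  rewrite /dpart big_distrl /=; apply: eq_bigr => n _.
  rewrite /f /Psi -!mulrA; congr (_ * _); rewrite !mulrA; congr (_ * _).
  by rewrite /vpow -cED; congr cE; rewrite rmorphN; ring.
have B1 : `|Re (CI (fun t' => \sum_(1 <= n < N.+1) f n t') - CI (fun t' => Phi k (x +i* t')))| <= 1 / (2 * eta) ^+ k * tau /\
  `|Im (CI (fun t' => \sum_(1 <= n < N.+1) f n t') - CI (fun t' => Phi k (x +i* t')))| <= 1 / (2 * eta) ^+ k * tau.
  apply: CI_bound; [exact: ccont_sum|exact: Phi_cont|move=> t' _].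
  rewrite fE /Phi -mulrBl normcM normcX normc_cE.
  have -> : expR (Re (- (x +i* t'))) = (eta / 2)^-1 by rewrite /= expRN ex.
  have nE : normc (cE (x +i* t')) = eta / 2 by rewrite normc_cE.
  have rE := Re_le_normc (cE (x +i* t')); have iE := Im_le_normc (cE (x +i* t')).
  rewrite nE !ler_norml in rE iE.
  have rr : sigma + eta / 2 <= Re (c + cE (x +i* t')) by rewrite cReD /=; move: rE; rewrite /=; lra.
  have ii : `|Im (c + cE (x +i* t'))| <= `|tr| + eta.
    rewrite cImD; apply: le_trans (ler_normD _ _) _; rewrite lerD2l ler_norml; lra.
  have -> : (g (c + cE (x +i* t')) : R[i]) = dirichlet_sum a (c + cE (x +i* t')).
    by apply: gF; [apply: cU; exact: disc|move: rr; rewrite /=; lra].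
  apply: le_trans (ler_wpM2r _ (hN0 _ _ NN rr ii)) _; first by rewrite exprn_ge0 // invr_ge0 ltW.
  by rewrite le_eqVlt; apply/orP; left; apply/eqP; rewrite /e exprVn; field; rewrite !gt_eqF.
have B2 : `|Re (CI (fun t' => Phi k (X +i* t')) - CI (fun=> 0))| <= `|M| / (2 * eta) ^+ k * tau /\
  `|Im (CI (fun t' => Phi k (X +i* t')) - CI (fun=> 0))| <= `|M| / (2 * eta) ^+ k * tau.
  apply: CI_bound; [exact: Phi_cont|exact: ccont_cst|move=> t' ht'].
  rewrite subr0 /Phi normcM normcX normc_cE /= expRN eX exprVn.
  rewrite ler_pM2r ?invr_gt0 //; apply: le_trans (ler_norm M).
  by have := hM t' ht'; rewrite /Phi expr0 mulr1.
have CI0 : CI (fun=> 0) = 0 :> R[i].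
  by apply: eqcP; rewrite /CI /= RI_cst ?mul0r // ltW.
rewrite CI0 !subr0 -PhiE in B2.
have CIf : CI (fun t' => \sum_(1 <= n < N.+1) f n t') =
  (tau * (-1) ^+ k)%:C * \sum_(1 <= n < N.+1) (a n)%:C * ((expR (- ((sigma + eta) * ln n%:R)) * cos (tr * ln n%:R) * ln n%:R ^+ k / k`!%:R) +i*
     (- (expR (- ((sigma + eta) * ln n%:R)) * sin (tr * ln n%:R) * ln n%:R ^+ k / k`!%:R))).
  rewrite CI_sum // big_distrr /=; apply: eq_bigr => n _.
  rewrite /f CIZ; last exact: ccont_Psi.
  rewrite CI_Psi /vpow rmorphM.
  have := small_term (sigma + eta) tr (ln n%:R) k; rewrite -/c.
  set A := cE _; set B := _ / _; set D := _ +i* _ => E.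
  have -> : (a n)%:C * A * (tau%:C * B) = tau%:C * (a n)%:C * (A * B) by ring.
  by rewrite E; ring.
set P := \sum_(1 <= n < N.+1) a n * _; set Q := \sum_(1 <= n < N.+1) a n * _.
have CIf' : CI (fun t' => \sum_(1 <= n < N.+1) f n t') = (tau * (-1) ^+ k)%:C * (P +i* (- Q)).
  rewrite CIf; congr (_ * _); rewrite /P /Q.
  elim/big_rec3: _ => [|n p q r _ ->]; first by rewrite oppr0.
  by apply: eqcP => /=; ring.
rewrite CIf' in B1.
have sgn (u : R) : `|tau * (-1) ^+ k * u| = tau * `|u|.
  by rewrite !normrM normrX normrN1 expr1n mulr1 (ger0_norm (ltW pi0)).
have fin (u v : R) : `|tau * (-1) ^+ k * u - v| <= 1 / (2 * eta) ^+ k * tau ->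
   `|v| <= `|M| / (2 * eta) ^+ k * tau -> `|u| <= C%:R / (2 * eta) ^+ k.
  move=> h1 h2; have : tau * `|u| <= ((`|M| + 1) / (2 * eta) ^+ k) * tau.
    rewrite -sgn; have -> : tau * (-1) ^+ k * u = (tau * (-1) ^+ k * u - v) + v by ring.
    apply: le_trans (ler_normD _ _) _; apply: le_trans (lerD h1 h2) _.
    by rewrite -mulrDl -mulrDl addrC.
  rewrite mulrC ler_pM2r // => h; apply: le_trans h _.
  rewrite ler_pM2r ?invr_gt0 //; apply: ltW; apply: archi_boundP.
  by rewrite addr_ge0.
case: B1 B2 => [b1 b2] [b3 b4].
split; first by apply: fin b3; move: b1; rewrite cReB cReM /= mul0r subr0.
by rewrite -normrN; apply: fin b4; move: b2; rewrite cImB cImM /= mul0r addr0.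
Qed.

End continuation.

Local Close Scope complex_scope.

(** * Rademacher sums *)

Section bounded_expectation.
Context (d : measure_display) (Omega : measurableType d) (R : realType)
  (P : probability Omega R).
Implicit Types f g : Omega -> R.

(** These functions form an algebra of integrable functions, so integrability conditions reduce to
    closure properties. *)
Definition bounded_mfun f := measurable_fun [set: Omega] f /\ exists M : R, forall w, `|f w| <= M.

Definition Ex f : R := \int[P]_w f w.

Lemma bounded_mfun_integrable f : bounded_mfun f -> P.-integrable [set: Omega] (EFin \o f).
Proof.
move=> [mf [M hM]]; apply: measurable_bounded_integrable => //.
  by rewrite (@le_lt_trans _ _ 1%E) ?ltry // probability_le1.
exists M; split; first by rewrite num_real.
by move=> x xM w _ /=; apply: le_trans (hM w) (ltW xM).
Qed.

Lemma bounded_mfun_cst (k : R) : bounded_mfun (fun=> k).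
Proof. by split; [exact: measurable_cst|exists `|k|]. Qed.

Lemma bounded_mfunD f g : bounded_mfun f -> bounded_mfun g -> bounded_mfun (fun w => f w + g w).
Proof.
move=> [mf [M hM]] [mg [N hN]]; split; first exact: measurable_funD.
by exists (M + N) => w; apply: le_trans (ler_normD _ _) _; exact: lerD.
Qed.

Lemma bounded_mfunM f g : bounded_mfun f -> bounded_mfun g -> bounded_mfun (fun w => f w * g w).
Proof.
move=> [mf [M hM]] [mg [N hN]]; split; first exact: measurable_funM.
by exists (M * N) => w; rewrite normrM; exact: ler_pM.
Qed.

Lemma bounded_mfun_indic A : measurable A -> bounded_mfun (\1_A).
Proof.
move=> mA; split; first exact: measurable_indic.
by exists 1 => w; rewrite indicE; case: (_ \in _); rewrite ?normr1 ?normr0.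
Qed.

Lemma bounded_mfun_sum (I : Type) (s : seq I) (f : I -> Omega -> R) :
  (forall i, bounded_mfun (f i)) -> bounded_mfun (fun w => \sum_(i <- s) f i w).
Proof.
move=> H; elim: s => [|i s IH].
  by under [X in bounded_mfun X]eq_fun do rewrite big_nil; exact: bounded_mfun_cst.
by under [X in bounded_mfun X]eq_fun do rewrite big_cons; exact: bounded_mfunD.
Qed.

Lemma Ex_cst (k : R) : Ex (fun=> k) = k.
Proof.
transitivity (k * fine (P [set: Omega])); first exact: Rintegral_cst.
by rewrite probability_setT mulr1.
Qed.

Lemma ExD f g : bounded_mfun f -> bounded_mfun g -> Ex (fun w => f w + g w) = Ex f + Ex g.
Proof. by move=> bf bg; rewrite /Ex RintegralD //; exact: bounded_mfun_integrable. Qed.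

Lemma ExZ (k : R) f : bounded_mfun f -> Ex (fun w => k * f w) = k * Ex f.
Proof. by move=> bf; rewrite /Ex RintegralZl //; exact: bounded_mfun_integrable. Qed.

Lemma Ex_sum (I : Type) (s : seq I) (f : I -> Omega -> R) : (forall i, bounded_mfun (f i)) ->
  Ex (fun w => \sum_(i <- s) f i w) = \sum_(i <- s) Ex (f i).
Proof.
move=> H; elim: s => [|i s IH].
  rewrite big_nil; under [X in Ex X]eq_fun do rewrite big_nil.
  exact: Ex_cst.
by under [X in Ex X]eq_fun do rewrite big_cons; rewrite ExD ?IH ?big_cons //; exact: bounded_mfun_sum.
Qed.

Lemma le_Ex f g : bounded_mfun f -> bounded_mfun g -> (forall w, f w <= g w) -> Ex f <= Ex g.
Proof. by move=> bf bg fg; apply: le_Rintegral => //; exact: bounded_mfun_integrable. Qed.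

Lemma Ex_indic A : measurable A -> Ex (\1_A) = fine (P A).
Proof. by move=> mA; rewrite /Ex /Rintegral integral_indic // setIT. Qed.

End bounded_expectation.

(** * Expectations of products of signs *)

Section rademacher.
Context (d : measure_display) (Omega : measurableType d) (R : realType)
  (P : probability Omega R) (I : eqType) (eps : I -> {RV P >-> R}).
Hypotheses (eps_val : forall m w, eps m w = 1 \/ eps m w = -1)
  (eps_pos : forall m, P [set w | eps m w = 1] = (2^-1)%:E)
  (eps_neg : forall m, P [set w | eps m w = -1] = (2^-1)%:E)
  (eps_indep : mutually_independent eps).
Local Notation Ex := (Ex P).

Definition cyl (J : seq I) (s : I -> R) := [set w | forall i, i \in J -> eps i w = s i].

Lemma measurable_eps_eq i (x : R) : measurable [set w | eps i w = x].
Proof.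
rewrite (_ : mkset _ = eps i @^-1` [set x]); last by apply/seteqP; split.
by rewrite -[X in measurable X]setTI; apply: measurable_funP.
Qed.

Lemma cyl_cons i J s : cyl (i :: J) s = [set w | eps i w = s i] `&` cyl J s.
Proof.
apply/seteqP; split=> w /=.
  by move=> H; split=> [|j jJ]; apply: H; rewrite inE ?eqxx ?jJ ?orbT.
by move=> [h1 h2] j; rewrite inE => /predU1P[->|/h2].
Qed.

Lemma measurable_cyl J s : measurable (cyl J s).
Proof.
elim: J => [|i J IH]; last by rewrite cyl_cons; apply: measurableI => //; exact: measurable_eps_eq.
by rewrite (_ : cyl _ _ = setT) //; apply/seteqP; split.
Qed.

Lemma prob_cyl J s : uniq J -> (forall i, s i = 1 \/ s i = -1) ->
  P (cyl J s) = ((2^-1) ^+ size J)%:E.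
Proof.
move=> uJ hs.
have -> : P (cyl J s) = (\prod_(i <- J) P (eps i @^-1` [set s i]))%E.
  by rewrite -(eps_indep (B := fun i => [set s i])).
elim: J {uJ} => [|i J IH]; first by rewrite big_nil.
rewrite big_cons IH exprS EFinM; congr (_ * _)%E.
by case: (hs i) => ->; [rewrite -(eps_pos i)|rewrite -(eps_neg i)].
Qed.

Lemma eps_sqr i w : eps i w * eps i w = 1.
Proof. by case: (eps_val i w) => ->; rewrite ?mulrNN mulr1. Qed.

Lemma bounded_mfun_eps i : bounded_mfun (eps i : Omega -> R).
Proof.
split; first exact: measurable_funP.
by exists 1 => w; case: (eps_val i w) => ->; rewrite ?normrN normr1.
Qed.

Lemma bounded_mfun_prod_eps (l : seq I) : bounded_mfun (fun w => \prod_(i <- l) eps i w).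
Proof.
elim: l => [|i l IH].
  by under [X in bounded_mfun X]eq_fun do rewrite big_nil; exact: bounded_mfun_cst.
by under [X in bounded_mfun X]eq_fun do rewrite big_cons; apply: bounded_mfunM => //; exact: bounded_mfun_eps.
Qed.

(** Writing a sign as [2 * 1_{eps i = 1} - 1] moves the index [i] from the product into the
    cylinder. When no sign is left, the two terms cancel because fixing one more sign halves the
    probability. Independence enters only through [prob_cyl]. *)
Lemma Ex_cyl_prod J l : uniq (J ++ l) -> l != [::] ->
  Ex (fun w => \1_(cyl J (fun=> 1)) w * \prod_(i <- l) eps i w) = 0.
Proof.
elim: l J => [//|i l IH] J uJl _.
have perm : uniq ((i :: J) ++ l) by rewrite -(perm_uniq (permEl (perm_catCA J [:: i] l))).
have uJ : uniq (J ++ l) by move: perm => /= /andP[].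
have uiJ : uniq (i :: J) by move: perm; rewrite cat_uniq => /andP[].
have E w : \1_(cyl J (fun=> 1)) w * \prod_(j <- (i :: l)) eps j w =
   2 * (\1_(cyl (i :: J) (fun=> 1)) w * \prod_(j <- l) eps j w)
   + -1 * (\1_(cyl J (fun=> 1)) w * \prod_(j <- l) eps j w) :> R.
  rewrite big_cons cyl_cons indicI /=.
  have -> : \1_[set w | eps i w = 1] w = (eps i w + 1) / 2 :> R.
    rewrite indicE; case: (eps_val i w) => e; rewrite e.
      by rewrite mem_set // divff.
    rewrite memNset ?addNr ?mul0r //= e => /eqP.
    by rewrite eq_sym -subr_eq0 opprK (_ : 1 + 1 = 2%:R) ?pnatr_eq0.
  by field.
under [X in Ex X]eq_fun do rewrite E.
have b J' : bounded_mfun (fun w => \1_(cyl J' (fun=> 1)) w * \prod_(j <- l) eps j w).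
  by apply: bounded_mfunM; [apply: bounded_mfun_indic; exact: measurable_cyl|exact: bounded_mfun_prod_eps].
rewrite ExD ?ExZ //; try by apply: bounded_mfunM; [exact: bounded_mfun_cst|exact: b].
have [l0|l0] := eqVneq l [::]; last by rewrite !IH // !mulr0 addr0.
have S J' : Ex (fun w => \1_(cyl J' (fun=> 1)) w * \prod_(j <- l) eps j w) = fine (P (cyl J' (fun=> 1))).
  rewrite -Ex_indic; last exact: measurable_cyl.
  by congr Ex; apply/funext => w; rewrite l0 big_nil mulr1.
rewrite !S !prob_cyl //; try (by move=> ?; left).
  by rewrite /= exprS; move: (_ ^+ size J) => x; field.
by move: uJ; rewrite cat_uniq => /andP[].
Qed.

Lemma Ex_prod_eps l : uniq l -> l != [::] -> Ex (fun w => \prod_(i <- l) eps i w) = 0.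
Proof.
move=> ul l0; rewrite -(@Ex_cyl_prod [::] l) //; congr Ex; apply/funext => w.
by rewrite indicE mem_set ?mul1r.
Qed.


End rademacher.

(** * Cauchy-Schwarz and off-diagonal sums *)

Lemma cauchy_schwarz_sum (R : realFieldType) (T : Type) (s : seq T) (x y : T -> R) :
  (\sum_(i <- s) x i * y i) ^+ 2 <= (\sum_(i <- s) x i ^+ 2) * (\sum_(i <- s) y i ^+ 2).
Proof.
set B := \sum_(i <- s) x i * y i; set X := \sum_(i <- s) _ ^+ 2; set Y := \sum_(i <- s) _ ^+ 2.
have X0 : 0 <= X by apply: sumr_ge0 => i _; exact: sqr_ge0.
have Q t : 0 <= t ^+ 2 * X - 2 * t * B + Y.
  have -> : t ^+ 2 * X - 2 * t * B + Y = \sum_(i <- s) (t * x i - y i) ^+ 2.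
    rewrite /X /B /Y !big_distrr /= -sumrB -big_split /=.
    by apply: eq_bigr => i _; ring.
  by apply: sumr_ge0 => i _; exact: sqr_ge0.
have [X1|X1] := eqVneq X 0.
  rewrite X1 mul0r; have [->|B0] := eqVneq B 0; first by rewrite expr0n.
  (* With [X = 0] the quadratic is linear in [t]; at this point it would equal -1. *)
  have := Q ((Y + 1) / (2 * B)); rewrite X1 mulr0 sub0r.
  have -> : 2 * ((Y + 1) / (2 * B)) * B = Y + 1 by field.
  lra.
have {X0}X0 : 0 < X by rewrite lt_neqAle eq_sym X1.
have := Q (B / X).
have -> : (B / X) ^+ 2 * X - 2 * (B / X) * B + Y = Y - B ^+ 2 / X by field.
by rewrite subr_ge0 ler_pdivrMr // mulrC.
Qed.

Fixpoint pairs (I : Type) (l : seq I) : seq (I * I) :=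
  if l is i :: l' then [seq (i, j) | j <- l'] ++ pairs l' else [::].

Lemma sqr_sum_pairs (R : comPzRingType) (I : Type) (l : seq I) (x : I -> R) :
  (\sum_(i <- l) x i) ^+ 2 =
  \sum_(i <- l) x i ^+ 2 + 2%:R * \sum_(p <- pairs l) x p.1 * x p.2.
Proof.
elim: l => [|i l IH]; first by rewrite !big_nil expr0n mulr0 addr0.
rewrite /= !big_cons big_cat big_map /= -big_distrr /= sqrrD IH.
by rewrite -[_ *+ 2]mulr_natl; ring.
Qed.

(** Pairs with one index in each list are dropped. Hence a bound on all pairs of an initial segment
    leaves little for the pairs of a later segment. *)
Lemma sum_pairs_cat (R : realDomainType) (I : Type) (l1 l2 : seq I) (F : I * I -> R) :
  (forall p, 0 <= F p) ->
  \sum_(p <- pairs l1) F p + \sum_(p <- pairs l2) F p <= \sum_(p <- pairs (l1 ++ l2)) F p.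
Proof.
move=> F0; elim: l1 => [|i l IH]; first by rewrite big_nil add0r.
rewrite /= !big_cat /= map_cat big_cat /= -!addrA lerD2l.
apply: le_trans IH _; rewrite lerDr; exact: sumr_ge0.
Qed.

Lemma pairs_mem (I : eqType) (l : seq I) p : p \in pairs l -> p.1 \in l /\ p.2 \in l.
Proof.
elim: l => [//|i l IH]; rewrite /= mem_cat => /orP[/mapP[j jl ->]|/IH[h1 h2]].
  by rewrite !inE eqxx jl orbT.
by rewrite !inE h1 h2 !orbT.
Qed.

Lemma pairs_neq (I : eqType) (l : seq I) p : uniq l -> p \in pairs l -> p.1 != p.2.
Proof.
elim: l => [//|i l IH] /= /andP[il ul]; rewrite mem_cat => /orP[/mapP[j jl ->]|/(IH ul)//].
by apply: contra il => /eqP /= ->.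
Qed.

Lemma uniq_pairs (I : eqType) (l : seq I) : uniq l -> uniq (pairs l).
Proof.
elim: l => [//|i l IH] /= /andP[il ul]; rewrite cat_uniq IH // andbT.
rewrite map_inj_uniq ?ul; last by move=> j k [].
apply/hasPn => p /pairs_mem[h1 _]; apply/mapP => -[j _ pE].
by move: h1; rewrite pE /= (negbTE il).
Qed.

(** * Bessel's inequality and second moments over an event *)

Section bessel.
Context (d : measure_display) (Omega : measurableType d) (R : realType)
  (P : probability Omega R).
Local Notation Ex := (Ex P).

(** [F] is the orthogonal projection of the indicator of [A], so [Ex (1_A F)] and [Ex (F F)] are
    both the sum of squares; the inequality is then [Ex ((1_A - F) ^ 2) >= 0]. *)
Lemma bessel (T : eqType) (s : seq T) (phi : T -> Omega -> R) (A : set Omega) :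
  measurable A -> (forall p, bounded_mfun (phi p)) -> uniq s ->
  {in s &, forall p q, Ex (fun w => phi p w * phi q w) = (p == q)%:R} ->
  \sum_(p <- s) Ex (fun w => \1_A w * phi p w) ^+ 2 <= fine (P A).
Proof.
move=> mA bphi us orth; set e := fun p => Ex (fun w => \1_A w * phi p w).
pose F w := \sum_(p <- s) e p * phi p w.
have bA : bounded_mfun (\1_A : Omega -> R) by exact: bounded_mfun_indic.
have bF1 p : bounded_mfun (fun w => e p * phi p w) by apply: bounded_mfunM; [exact: bounded_mfun_cst|].
have bF : bounded_mfun F by exact: bounded_mfun_sum.
have bAF : bounded_mfun (fun w => \1_A w * F w) by exact: bounded_mfunM.
have EAF : Ex (fun w => \1_A w * F w) = \sum_(p <- s) e p ^+ 2.
  have E w : \1_A w * F w = \sum_(p <- s) e p * (\1_A w * phi p w).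
    by rewrite /F big_distrr /=; apply: eq_bigr => p _; ring.
  under [X in Ex X]eq_fun do rewrite E.
  have b p : bounded_mfun (fun w => \1_A w * phi p w) by exact: bounded_mfunM.
  rewrite Ex_sum; last by move=> p; apply: bounded_mfunM; [exact: bounded_mfun_cst|].
  by apply: eq_bigr => p _; rewrite ExZ.
have EFF : Ex (fun w => F w * F w) = \sum_(p <- s) e p ^+ 2.
  have E w : F w * F w = \sum_(p <- s) \sum_(q <- s) (e p * e q) * (phi p w * phi q w).
    rewrite /F big_distrl /=; apply: eq_bigr => p _.
    by rewrite big_distrr /=; apply: eq_bigr => q _; ring.
  under [X in Ex X]eq_fun do rewrite E.
  have b p q : bounded_mfun (fun w => phi p w * phi q w) by exact: bounded_mfunM.
  have b' p q : bounded_mfun (fun w => (e p * e q) * (phi p w * phi q w)) by apply: bounded_mfunM; [exact: bounded_mfun_cst|].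
  rewrite Ex_sum; last by move=> p; exact: bounded_mfun_sum.
  rewrite big_seq [RHS]big_seq; apply: eq_bigr => p ps.
  rewrite Ex_sum // (bigD1_seq p) //= ExZ // orth // eqxx mulr1 -expr2.
  rewrite big_seq_cond big1 ?addr0 // => q /andP[qs qp].
  by rewrite ExZ // orth // eq_sym (negbTE qp) mulr0.
have : 0 <= Ex (fun w => (\1_A w - F w) ^+ 2).
  by apply: Rintegral_ge0 => w _; exact: sqr_ge0.
have E w : (\1_A w - F w) ^+ 2 = \1_A w + (- 2 * (\1_A w * F w) + F w * F w).
  have -> : (\1_A w - F w) ^+ 2 = \1_A w * \1_A w + (- 2 * (\1_A w * F w) + F w * F w) by ring.
  by congr (_ + _); rewrite indicE; case: (_ \in _); rewrite ?mulr1 ?mulr0.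
under [X in Ex X]eq_fun do rewrite E.
have b2 : bounded_mfun (fun w => - 2 * (\1_A w * F w)) by apply: bounded_mfunM; [exact: bounded_mfun_cst|].
have b3 : bounded_mfun (fun w => F w * F w) by exact: bounded_mfunM.
rewrite ExD //; last exact: bounded_mfunD.
rewrite ExD // ExZ // EAF EFF.
by rewrite Ex_indic //; lra.
Qed.

Context (I : eqType) (eps : I -> {RV P >-> R}).
Hypotheses (eps_val : forall m w, eps m w = 1 \/ eps m w = -1)
  (eps_pos : forall m, P [set w | eps m w = 1] = (2^-1)%:E)
  (eps_neg : forall m, P [set w | eps m w = -1] = (2^-1)%:E)
  (eps_indep : mutually_independent eps).

Let epsM (p : I * I) (w : Omega) : R := eps p.1 w * eps p.2 w.

Let Ex_uniq l : uniq l -> l != [::] -> Ex (fun w => \prod_(i <- l) eps i w) = 0.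
Proof. exact: Ex_prod_eps. Qed.

Let Ex2 i j : i != j -> Ex (fun w => eps i w * eps j w) = 0.
Proof.
move=> ij; rewrite -(@Ex_uniq [:: i; j]) //=; last by rewrite inE ij.
by congr Ex; apply/funext => w; rewrite !big_cons big_nil mulr1.
Qed.

(** The index [i] occurs only once. If [j] meets [k] or [m] their squares disappear and two distinct
    signs remain; otherwise all four are distinct. *)
Let Ex4 i j k m : i \notin [:: j; k; m] -> k != m ->
  Ex (fun w => eps i w * eps j w * (eps k w * eps m w)) = 0.
Proof.
rewrite !inE !negb_or => /and3P[ij ik im] km.
have [jk|jk] := eqVneq j k.
  rewrite -(Ex2 im); congr Ex; apply/funext => w.
  by rewrite jk -mulrA (mulrA (eps k w)) (eps_sqr eps_val) mul1r.
have [jm|jm] := eqVneq j m.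
  rewrite -(Ex2 ik); congr Ex; apply/funext => w.
  by rewrite jm -mulrA (mulrCA (eps m w)) (eps_sqr eps_val) mulr1.
rewrite -(@Ex_uniq [:: i; j; k; m]) //=; last by rewrite !inE !negb_or ij ik im jk jm km.
by congr Ex; apply/funext => w; rewrite !big_cons big_nil mulr1 !mulrA.
Qed.

Let epsM_orth l : uniq l ->
  {in pairs l &, forall p q, Ex (fun w => epsM p w * epsM q w) = (p == q)%:R}.
Proof.
have EC p q : Ex (fun w => epsM p w * epsM q w) = Ex (fun w => epsM q w * epsM p w).
  by congr Ex; apply/funext => w; rewrite mulrC.
elim: l => [//|i l IH] /= /andP[il ul] p q.
have mix j r : r \in pairs l -> j \in l -> Ex (fun w => epsM (i, j) w * epsM r w) = ((i, j) == r)%:R.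
  move=> rl jl; have [r1 r2] := pairs_mem rl.
  have ir x : x \in l -> i != x by move=> xl; apply: contraNneq il => ->.
  rewrite /epsM /= Ex4 ?(pairs_neq ul rl) // ?inE ?negb_or ?ir //.
  by case: eqP => // rE; move: r1; rewrite -rE (negbTE il).
rewrite !mem_cat => /orP[/mapP[j jl ->]|pl] /orP[/mapP[k kl ->]|ql].
- have [->|jk] := eqVneq j k.
    rewrite eqxx -[RHS](Ex_cst P); congr Ex; apply/funext => w.
    by rewrite /epsM /= mulrACA !(eps_sqr eps_val) mulr1.
  rewrite xpair_eqE eqxx (negbTE jk) /= mulr0n -[RHS](Ex2 jk); congr Ex; apply/funext => w.
  by rewrite /epsM /= mulrACA (eps_sqr eps_val) mul1r.
- exact: mix.
- by rewrite EC mix // eq_sym.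
- exact: IH.
Qed.

Let bounded_mfun_epsM p : bounded_mfun (epsM p).
Proof. by apply: bounded_mfunM; exact: bounded_mfun_eps. Qed.

(** In the expanded square the diagonal gives [P(A)] times the sum [S] of the [a i ^+ 2]. The
    off-diagonal part is at most [2 * dl * S] by Cauchy-Schwarz, as the squares of [a i * a j] over
    pairs sum to at most [S ^+ 2]. *)
Lemma Ex_sqr_lower A l (a : I -> R) (dl : R) : measurable A -> uniq l -> 0 <= dl ->
  \sum_(p <- pairs l) Ex (fun w => \1_A w * epsM p w) ^+ 2 <= dl ^+ 2 ->
  (fine (P A) - 2 * dl) * \sum_(i <- l) a i ^+ 2 <=
    Ex (fun w => \1_A w * (\sum_(i <- l) a i * eps i w) ^+ 2).
Proof.
move=> mA ul dl0 hdl; set e := fun p => Ex (fun w => \1_A w * epsM p w) in hdl *.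
pose S := \sum_(i <- l) a i ^+ 2.
have S0 : 0 <= S by apply: sumr_ge0 => i _; exact: sqr_ge0.
have E w : \1_A w * (\sum_(i <- l) a i * eps i w) ^+ 2 =
   S * \1_A w + \sum_(p <- pairs l) (2 * (a p.1 * a p.2)) * (\1_A w * epsM p w) :> R.
  rewrite sqr_sum_pairs mulrDr; congr (_ + _).
    rewrite mulrC; congr (_ * _); apply: eq_bigr => i _.
    by rewrite exprMn [eps i w ^+ 2](eps_sqr eps_val) mulr1.
  rewrite mulrCA mulrA big_distrr /=; apply: eq_bigr => p _.
  by rewrite /epsM; ring.
have bA : bounded_mfun (\1_A : Omega -> R) by exact: bounded_mfun_indic.
have b p : bounded_mfun (fun w => \1_A w * epsM p w) by exact: bounded_mfunM.
have b' p : bounded_mfun (fun w => (2 * (a p.1 * a p.2)) * (\1_A w * epsM p w)) by apply: bounded_mfunM; [exact: bounded_mfun_cst|].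
under [X in Ex X]eq_fun do rewrite E.
rewrite ExD //; [|by apply: bounded_mfunM; [exact: bounded_mfun_cst|]|exact: bounded_mfun_sum].
rewrite ExZ // Ex_indic // Ex_sum //.
rewrite (eq_bigr (fun p => 2 * (a p.1 * a p.2 * e p))); last by move=> p _; rewrite ExZ // -!mulrA.
rewrite -big_distrr /=.
set T := \sum_(p <- pairs l) _.
have CS := cauchy_schwarz_sum (pairs l) (fun p => a p.1 * a p.2) e.
have X : \sum_(p <- pairs l) (a p.1 * a p.2) ^+ 2 <= S ^+ 2.
  rewrite /S sqr_sum_pairs; under eq_bigr do rewrite exprMn.
  set U := \sum_(p <- pairs l) _.
  have U0 : 0 <= U by apply: sumr_ge0 => p _; rewrite mulr_ge0 // sqr_ge0.
  have : 0 <= \sum_(i <- l) (a i ^+ 2) ^+ 2 by apply: sumr_ge0 => p _; exact: sqr_ge0.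
  lra.
have T2 : T ^+ 2 <= (S * dl) ^+ 2.
  apply: le_trans CS _; rewrite exprMn; apply: ler_pM => //.
    by apply: sumr_ge0 => p _; exact: sqr_ge0.
  by apply: sumr_ge0 => p _; exact: sqr_ge0.
have Tb : `|T| <= S * dl.
  by rewrite -(ger0_norm (mulr_ge0 S0 dl0)) -ler_sqr ?nnegrE // !real_normK ?num_real.
move: Tb; rewrite ler_norml => /andP[Tb _].
rewrite -/S; lra.
Qed.

(* Functions of the form [sum a_i eps_i] with [i] far in the tail are almost
   uncorrelated with any fixed event, because the correlations of [A] with the
   orthonormal products [eps_i eps_j] are square summable. *)
Lemma Ex_sqr_tail A (L : nat -> nat -> seq I) :
  (forall m n, uniq (L m n)) ->
  (forall m n, (m <= n)%N -> L 0%N n = L 0%N m ++ L m n) ->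
  measurable A -> 0 < fine (P A) ->
  exists N0, forall N (a : I -> R), (N0 <= N)%N ->
    fine (P A) / 2 * \sum_(i <- L N0 N) a i ^+ 2 <=
      Ex (fun w => \1_A w * (\sum_(i <- L N0 N) a i * eps i w) ^+ 2).
Proof.
move=> uL catL mA pA; set p := fine (P A).
pose e q := Ex (fun w => \1_A w * epsM q w) ^+ 2.
pose D n := \sum_(q <- pairs (L 0%N n)) e q.
have Dp n : D n <= p.
  apply: bessel => //; first by exact/uniq_pairs/uL.
  exact/epsM_orth/uL.
(* This makes [p - 2 * dl = p / 2]. [N0] is taken where the increasing sums [D], bounded by Bessel,
   are within [dl ^+ 2] of their supremum. *)
pose dl := p / 4; have dl0 : 0 < dl by rewrite divr_gt0.
have hasS : has_sup (range D).
  by split; [exists (D 0%N), 0%N|exists p => _ [n _ <-]; exact: Dp].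
have dl2 : 0 < dl ^+ 2 by rewrite exprn_gt0.
have [_ [N0 _ <-] hN0] := sup_adherent dl2 hasS.
exists N0 => N a NN.
have -> : p / 2 = p - 2 * dl by rewrite /dl; field.
apply: Ex_sqr_lower => //; first exact: ltW.
have := @sum_pairs_cat R I (L 0%N N0) (L N0 N) e (fun q => sqr_ge0 _).
rewrite -catL // -/(D N0) -/(D N).
have : D N <= sup (range D) by apply: ub_le_sup; [case: hasS|exists N].
rewrite -/e; lra.
Qed.

End bessel.

(** * Kolmogorov's maximal inequality for signs *)

Section maximal_inequality.
Context (d : measure_display) (Omega : measurableType d) (R : realType)
  (P : probability Omega R) (I : eqType) (eps : I -> {RV P >-> R}).
Hypotheses (eps_val : forall m w, eps m w = 1 \/ eps m w = -1)
  (eps_pos : forall m, P [set w | eps m w = 1] = (2^-1)%:E)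
  (eps_neg : forall m, P [set w | eps m w = -1] = (2^-1)%:E)
  (eps_indep : mutually_independent eps).
Variables (c : I -> R) (t : R).
Hypothesis t0 : 0 < t.

(* Some partial sum of [a + sum c_i eps_i] along [l] reaches modulus [t]. *)
Fixpoint exceed (l : seq I) (a : R) : set Omega :=
  [set w | t <= `|a|] `|`
  (if l is i :: l' then
    ([set w | eps i w = 1] `&` exceed l' (a + c i)) `|`
    ([set w | eps i w = -1] `&` exceed l' (a - c i))
  else set0).

Lemma measurable_exceed l a : measurable (exceed l a).
Proof.
have m0 b : measurable ([set w | t <= `|b|] : set Omega).
  have [h|h] := boolP (t <= `|b|).
    by rewrite (_ : mkset _ = setT) //; apply/seteqP; split.
  by rewrite (_ : mkset _ = set0) //; apply/seteqP; split=> // w; rewrite /= (negbTE h).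
elim: l a => [|i l IH] a /=; first by rewrite setU0.
by apply: measurableU => //; apply: measurableU; apply: measurableI => //; exact: measurable_eps_eq.
Qed.

Lemma exceed_take l a w k : t <= `|a + \sum_(i <- take k l) c i * eps i w| -> exceed l a w.
Proof.
elim: l a k => [|i l IH] a [|k] /=; rewrite ?big_nil ?addr0; try by left.
rewrite big_cons addrA => /IH H; right.
by case: (eps_val i w) H => ->; rewrite ?mulrN mulr1 => H; [left|right].
Qed.

Lemma exceed_cat l l' a : exceed l a `<=` exceed (l ++ l') a.
Proof.
elim: l a => [|i l IH] a w /=.
  by case=> // h; case: l' => [|j l']; left.
case=> [h|[[h1 /IH h2]|[h1 /IH h2]]]; first by left.
  by right; left.
by right; right.
Qed.

(** The cylinder and the starting value [a] make an induction on [l] possible that splits on the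
    next sign, with no stopping time. If [|a|] already reaches [t], the bound exceeds the
    probability of the cylinder. *)
Lemma kolmogorov_cyl l J s a : uniq (J ++ l) -> (forall i, s i = 1 \/ s i = -1) ->
  fine (P (cyl eps J s `&` exceed l a)) <=
    (2^-1) ^+ size J * ((a ^+ 2 + \sum_(i <- l) c i ^+ 2) / t ^+ 2).
Proof.
have t2 : 0 < t ^+ 2 by rewrite exprn_gt0.
have fle A B : measurable A -> measurable B -> A `<=` B -> fine (P A) <= fine (P B).
  by move=> mA mB AB; apply: fine_le; rewrite ?fin_num_measure //; apply: le_measure; rewrite ?inE.
have sum0 l' : 0 <= \sum_(i <- l') c i ^+ 2 by apply: sumr_ge0 => i _; exact: sqr_ge0.
have big l' J' s' b : uniq J' -> (forall i, s' i = 1 \/ s' i = -1) -> t <= `|b| ->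
    fine (P (cyl eps J' s' `&` exceed l' b)) <=
    (2^-1) ^+ size J' * ((b ^+ 2 + \sum_(i <- l') c i ^+ 2) / t ^+ 2).
  move=> uJ hs tb; apply: (@le_trans _ _ (fine (P (cyl eps J' s')))).
    apply: fle; last exact: subIsetl.
      by apply: measurableI; [exact: measurable_cyl|exact: measurable_exceed].
    exact: measurable_cyl.
  rewrite (prob_cyl eps_pos eps_neg eps_indep) //= -[leLHS]mulr1 ler_pM2l ?exprn_gt0 ?invr_gt0 //.
  rewrite ler_pdivlMr // mul1r -(real_normK (num_real b)).
  apply: (@le_trans _ _ (`|b| ^+ 2)); first by rewrite ler_sqr ?nnegrE // ltW.
  by rewrite lerDl.
elim: l J s a => [|i l IH] J s a uJl hs.
  have uJ : uniq J by rewrite -(cats0 J).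
  have [|ta] := leP t `|a|; first exact: big.
  rewrite (_ : _ `&` _ = set0) ?measure0 /=.
    by rewrite mulr_ge0 ?exprn_ge0 ?invr_ge0 // divr_ge0 ?addr_ge0 ?sqr_ge0 // ltW.
  by apply/seteqP; split=> // w [_] [] //=; rewrite leNgt ta.
have uiJl : uniq ((i :: J) ++ l) by rewrite -(perm_uniq (permEl (perm_catCA J [:: i] l))).
have uJ : uniq J by move: uJl; rewrite cat_uniq => /andP[].
have [|ta] := leP t `|a|; first exact: big.
have iJ : i \notin J by move: uiJl => /= /andP[]; rewrite mem_cat negb_or => /andP[].
pose s1 b j := if j == i then b else s j.
have cylE b : cyl eps (i :: J) (s1 b) = [set w | eps i w = b] `&` cyl eps J s.
  rewrite cyl_cons {1}/s1 eqxx; congr (_ `&` _).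
  apply/seteqP; split=> w /= H j jJ; have := H j jJ; rewrite /s1;
    by have [ji|//] := eqVneq j i; rewrite -ji jJ in iJ.
have hs1 b : b = 1 \/ b = -1 -> forall j, s1 b j = 1 \/ s1 b j = -1.
  by move=> hb j; rewrite /s1; case: eqP.
have A1 := IH (i :: J) (s1 1) (a + c i) uiJl (hs1 1 (or_introl erefl)).
have A2 := IH (i :: J) (s1 (-1)) (a - c i) uiJl (hs1 (-1) (or_intror erefl)).
pose U1 := cyl eps (i :: J) (s1 1) `&` exceed l (a + c i).
pose U2 := cyl eps (i :: J) (s1 (-1)) `&` exceed l (a - c i).
have mU1 : measurable U1 by apply: measurableI; [exact: measurable_cyl|exact: measurable_exceed].
have mU2 : measurable U2 by apply: measurableI; [exact: measurable_cyl|exact: measurable_exceed].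
have sub : cyl eps J s `&` exceed (i :: l) a `<=` U1 `|` U2.
  rewrite /U1 /U2 !cylE => w [h1] /=; rewrite leNgt ta => -[//|[[h2 h3]|[h2 h3]]]; [left|right]; by [].
apply: (@le_trans _ _ (fine (P U1) + fine (P U2))).
  apply: (@le_trans _ _ (fine (P (U1 `|` U2)))).
    apply: fle => //; last exact: measurableU.
    by apply: measurableI; [exact: measurable_cyl|exact: measurable_exceed].
  rewrite -fineD ?fin_num_measure //; apply: fine_le; rewrite ?fin_numD ?fin_num_measure //;
    try exact: measurableU.
  exact: measureU2.
apply: le_trans (lerD A1 A2) _.
(* The average of [(a + c i) ^+ 2] and [(a - c i) ^+ 2] is [a ^+ 2 + c i ^+ 2]. *)
rewrite big_cons /= exprS le_eqVlt; apply/orP; left; apply/eqP.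
by move: ((2^-1) ^+ size J) => x; field; rewrite gt_eqF.
Qed.

Lemma kolmogorov l : uniq l ->
  fine (P (exceed l 0)) <= (\sum_(i <- l) c i ^+ 2) / t ^+ 2.
Proof.
move=> ul; have := @kolmogorov_cyl l [::] (fun=> 1) 0 ul (fun=> or_introl erefl).
rewrite (_ : cyl _ _ _ = setT); last by apply/seteqP; split.
by rewrite setTI expr0 mul1r expr0n add0r.
Qed.

End maximal_inequality.

(** * Almost sure convergence of square-summable sign series *)

Section ae_convergence.
Context (d : measure_display) (Omega : measurableType d) (R : realType)
  (P : probability Omega R) (I : eqType) (eps : I -> {RV P >-> R}).
Hypotheses (eps_val : forall m w, eps m w = 1 \/ eps m w = -1)
  (eps_pos : forall m, P [set w | eps m w = 1] = (2^-1)%:E)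
  (eps_neg : forall m, P [set w | eps m w = -1] = (2^-1)%:E)
  (eps_indep : mutually_independent eps).

(** Outside [B j] the sums starting at some rank [N] never reach [1 / (j + 1)]. By Kolmogorov [B j]
    has probability at most the remaining variance [sup V - V N] divided by the square of that
    threshold, and this tends to 0. *)
Lemma rademacher_ae_cauchy (L : nat -> nat -> seq I) (c : I -> R) (K : R) :
  (forall m n, uniq (L m n)) ->
  (forall m n k, (m <= n)%N -> (n <= k)%N -> L m k = L m n ++ L n k) ->
  (forall N, \sum_(i <- L 0%N N) c i ^+ 2 <= K) ->
  {ae P, forall w, forall e : R, 0 < e -> exists N, forall n m, (N <= n)%N -> (n <= m)%N ->
    `|\sum_(i <- L 0%N m) c i * eps i w - \sum_(i <- L 0%N n) c i * eps i w| <= e}.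
Proof.
move=> uL catL hK.
pose V n := \sum_(i <- L 0%N n) c i ^+ 2.
have hasS : has_sup (range V).
  by split; [exists (V 0%N), 0%N|exists K => _ [n _ <-]; exact: hK].
pose tt (j : nat) : R := j.+1%:R^-1.
have tt0 j : 0 < tt j by rewrite invr_gt0 ltr0n.
pose G j N := \bigcup_M exceed eps c (tt j) (L N (N + M)%N) 0.
have mE j N M : measurable (exceed eps c (tt j) (L N (N + M)%N) 0) by exact: measurable_exceed.
have mG j N : measurable (G j N) by apply: bigcupT_measurable.
pose B j := \bigcap_N G j N.
have mB j : measurable (B j) by apply: bigcapT_measurable.
have PB j : P (B j) = 0%E.
  apply/eqP; rewrite eq_le measure_ge0 andbT.
  apply/lee_addgt0Pr => /= e e0; rewrite add0e.
  have et : 0 < e * tt j ^+ 2 by rewrite mulr_gt0 // exprn_gt0.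
  have [_ [N _ <-] hN] := sup_adherent et hasS.
  apply: (@le_trans _ _ (P (G j N))).
    by apply: le_measure; rewrite ?inE //; exact: bigcap_inf.
  (* Kolmogorov's inequality covers finite lists; continuity from below extends it to the whole tail
     [G j N]. *)
  have nd : nondecreasing_seq (fun M => exceed eps c (tt j) (L N (N + M)%N) 0).
    move=> m n mn; apply/subsetPset.
    rewrite (catL N (N + m)%N (N + n)%N) ?leq_addr ?leq_add2l //; exact: exceed_cat.
  have cv := @nondecreasing_cvg_mu _ _ _ P _ (mE j N) (mG j N) nd.
  rewrite -(cvg_lim _ cv) //; apply: lime_le; first by apply/cvg_ex; eexists; exact: cv.
  near=> M; rewrite -[leLHS]fineK ?fin_num_measure // lee_fin.
  apply: le_trans (kolmogorov eps_pos eps_neg eps_indep c (tt0 j) (uL _ _)) _.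
  rewrite ler_pdivrMr ?exprn_gt0 //.
  have VE : V (N + M)%N = V N + \sum_(i <- L N (N + M)%N) c i ^+ 2.
    by rewrite /V (catL 0%N N (N + M)%N) ?leq_addr // big_cat.
  have : V (N + M)%N <= sup (range V) by apply: ub_le_sup; [case: hasS|eexists].
  move: hN; rewrite VE; lra.
exists (\bigcup_j B j); split; first exact: bigcupT_measurable.
  apply/eqP; rewrite eq_le measure_ge0 andbT.
  apply: le_trans (measure_sigma_subadditive _ _ _ _) _; [exact: mB|exact: bigcupT_measurable|by []|].
  by rewrite eseries0 // => j _ _; exact: PB.
move=> w; apply: contra_notP => /= hB e e0.
pose j := Num.bound (2 / e).
(* Two partial sums are compared through their common rank [N], which costs the threshold twice. *)
have te : 2 * tt j <= e.
  rewrite /tt ler_pdivrMr ?ltr0n // mulrC -ler_pdivrMr //.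
  apply: ltW; apply: lt_trans (archi_boundP _) _; first by rewrite divr_ge0 // ltW.
  by rewrite ltr_nat.
have : ~ B j w by move=> h; apply: hB; exists j.
move=> /existsNP[N] /not_implyP[_ hG].
have near_N n : (N <= n)%N -> `|\sum_(i <- L N n) c i * eps i w| < tt j.
  move=> Nn; rewrite ltNge; apply/negP => h; apply: hG; exists (n - N)%N => //.
  apply: (@exceed_take _ _ _ _ _ _ eps_val _ _ _ _ _ (size (L N n))).
  by rewrite subnKC // take_size add0r.
exists N => n m Nn nm.
have SE k : (N <= k)%N -> \sum_(i <- L 0%N k) c i * eps i w =
   \sum_(i <- L 0%N N) c i * eps i w + \sum_(i <- L N k) c i * eps i w.
  by move=> Nk; rewrite (catL 0%N N k) // big_cat.
rewrite (SE n Nn) (SE m (leq_trans Nn nm)).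
have := near_N n Nn; have := near_N m (leq_trans Nn nm).
set x := \sum_(i <- L N m) _; set y := \sum_(i <- L N n) _; set z := \sum_(i <- _) _.
have -> : z + x - (z + y) = x - y by ring.
have := ler_normB x y; lra.
Unshelve. all: by end_near. Qed.

End ae_convergence.

(** * Proof of the theorem *)

Lemma cvg_sum_seq (R : realType) (T : Type) (s : seq T) (f : T -> nat -> R) (l : T -> R) :
  (forall i, f i @ \oo --> l i) ->
  (fun n => \sum_(i <- s) f i n) @ \oo --> \sum_(i <- s) l i.
Proof.
move=> H; elim: s => [|i s IH].
  rewrite big_nil (_ : (fun _ => _) = cst 0) //; first exact: cvg_cst.
  by apply/funext => n; rewrite big_nil.
rewrite big_cons (_ : (fun _ => _) = (fun n => f i n + \sum_(j <- s) f j n)).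
  by apply: cvgD.
by apply/funext => n; rewrite big_cons.
Qed.

Lemma geometric_le (R : realFieldType) (K : nat) : \sum_(k < K) (9 / 16 : R) ^+ k <= 4.
Proof.
have : \sum_(k < K) (9 / 16 : R) ^+ k <= 16 / 7 * (1 - (9 / 16) ^+ K).
  elim: K => [|K IH]; first by rewrite big_ord0 expr0 subrr mulr0.
  rewrite big_ord_recr /= exprS; have : 0 <= (9 / 16 : R) ^+ K by rewrite exprn_ge0.
  move: IH; lra.
have : 0 <= (9 / 16 : R) ^+ K by rewrite exprn_ge0.
lra.
Qed.

(* By Cauchy-Schwarz, [(sum_k (q^2 x)^k / k!)^2 <= (sum_k q^(2k)) (sum_k q^(2k) (x^k / k!)^2)],
   here with [q = 3/4] and [x = 2 eta l]. *)
Lemma weighted_exp_sum_bound (R : realType) (T : Type) (s : seq T) (v l : T -> R) (eta D : R) :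
  0 < eta -> (forall i, 0 <= v i) ->
  (forall k, \sum_(i <- s) v i * (l i ^+ k / k`!%:R) ^+ 2 <= D / ((2 * eta) ^+ k) ^+ 2) ->
  \sum_(i <- s) v i * expR (9 / 4 * eta * l i) <= 16 * D.
Proof.
move=> eta0 v0 H.
have cv i : (fun K => v i * (\sum_(k < K) (9 / 8 * eta * l i) ^+ k / k`!%:R) ^+ 2) @ \oo
    --> v i * expR (9 / 4 * eta * l i).
  (* The exponential is split as a square so that its truncated series can be squared; [9 / 8 * eta]
     is [(3 / 4) ^+ 2] times [2 * eta]. *)
  have -> : 9 / 4 * eta * l i = 9 / 8 * eta * l i + 9 / 8 * eta * l i by field.
  rewrite expRD -expr2.
  have c1 : (fun K => \sum_(k < K) (9 / 8 * eta * l i) ^+ k / k`!%:R) @ \oo --> expR (9 / 8 * eta * l i).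
    have := is_cvg_series_exp_coeff (9 / 8 * eta * l i); rewrite /expR.
    set u := (fun _ => _); suff -> : u = series (exp_coeff (9 / 8 * eta * l i)) by [].
    by apply/funext => n; rewrite /u /series /= big_mkord.
  by apply: cvgM; [exact: cvg_cst|rewrite expr2; apply: cvgM].
have C := cvg_sum_seq (s := s) cv.
rewrite -(cvg_lim (@Rhausdorff R) C).
apply: limr_le; [by apply/cvg_ex; eexists; exact: C|near=> K].
have p0 k : 0 < (2 * eta) ^+ k by rewrite exprn_gt0 // mulr_gt0.
have q2 k : (9 / 16 : R) ^+ k = ((3 / 4) ^+ k) ^+ 2.
  by rewrite -exprM mulnC exprM; congr (_ ^+ _); field.
have step i : (\sum_(k < K) (9 / 8 * eta * l i) ^+ k / k`!%:R) ^+ 2 <=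
    4 * \sum_(k < K) (9 / 16) ^+ k * ((2 * eta) ^+ k) ^+ 2 * (l i ^+ k / k`!%:R) ^+ 2.
  have CS := cauchy_schwarz_sum (index_enum 'I_K) (fun k => (3 / 4 : R) ^+ k)
    (fun k => (3 / 4) ^+ k * ((2 * eta) ^+ k * (l i ^+ k / k`!%:R))).
  rewrite (eq_bigr (fun k : 'I_K => (3 / 4 : R) ^+ k * ((3 / 4) ^+ k * ((2 * eta) ^+ k * (l i ^+ k / k`!%:R))))).
    apply: (le_trans CS); apply: ler_pM.
    - by apply: sumr_ge0 => k _; exact: sqr_ge0.
    - by apply: sumr_ge0 => k _; exact: sqr_ge0.
    - rewrite (eq_bigr (fun k : 'I_K => (9 / 16 : R) ^+ k)); first exact: geometric_le.
      by move=> k _; rewrite q2.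
    - rewrite le_eqVlt; apply/orP; left; apply/eqP; apply: eq_bigr => k _.
      by rewrite q2; ring.
  move=> k _; have -> : 9 / 8 * eta * l i = (3 / 4) * (3 / 4) * (2 * eta) * l i by field.
  by rewrite !exprMn; ring.
apply: (@le_trans _ _ (\sum_(i <- s) v i * (4 * \sum_(k < K) (9 / 16) ^+ k * ((2 * eta) ^+ k) ^+ 2 * (l i ^+ k / k`!%:R) ^+ 2))).
  by apply: ler_sum => i _; rewrite ler_wpM2l.
have -> : \sum_(i <- s) v i * (4 * \sum_(k < K) (9 / 16) ^+ k * ((2 * eta) ^+ k) ^+ 2 * (l i ^+ k / k`!%:R) ^+ 2) =
  4 * \sum_(k < K) (9 / 16) ^+ k * (((2 * eta) ^+ k) ^+ 2 * \sum_(i <- s) v i * (l i ^+ k / k`!%:R) ^+ 2).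
  under eq_bigr do rewrite mulrCA big_distrr /=.
  rewrite -big_distrr /= exchange_big /=; congr (_ * _); apply: eq_bigr => k _.
  by rewrite !big_distrr /=; apply: eq_bigr => i _; ring.
have D0 : 0 <= D.
  have := H 0%N; rewrite !expr0 expr1n divr1; apply: le_trans.
  by apply: sumr_ge0 => i _; rewrite mulr_ge0 // sqr_ge0.
apply: (@le_trans _ _ (4 * \sum_(k < K) (9 / 16) ^+ k * D)).
  rewrite ler_pM2l //; apply: ler_sum => k _; rewrite ler_wpM2l ?exprn_ge0 //.
  by rewrite mulrC -ler_pdivlMr; [exact: H|rewrite exprn_gt0].
by rewrite -big_distrl /=; have := geometric_le R K; nra.
Unshelve. all: by end_near. Qed.

(** Choosing [N k] to lose at most [p / 2 / 2 ^ k.+1] of [A] makes the total loss at most [p / 2].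
    This makes the ranks beyond which bounds hold independent of the outcome, for all [k] at
    once. *)
Lemma egorov_choice (d : measure_display) (T : measurableType d) (R : realType)
  (P : probability T R) (A : set T) (F : nat -> nat -> set T) :
  measurable A -> (forall k N, measurable (F k N)) ->
  (forall k, nondecreasing_seq (F k)) -> (forall k, A `<=` \bigcup_N F k N) ->
  0 < fine (P A) ->
  exists N : nat -> nat, 0 < fine (P (A `&` \bigcap_k F k (N k))).
Proof.
move=> mA mF ndF AF pA; set p := fine (P A) in pA.
have mAF k N : measurable (A `&` F k N) by exact: measurableI.
have ex k : exists N, (P (A `\` F k N) <= (p / 2 / (2 ^ k.+1)%:R)%:E)%E.
  have e0 : 0 < p / 2 / (2 ^ k.+1)%:R :> R by rewrite !divr_gt0 // ltr0n expn_gt0.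
  have nd : nondecreasing_seq (fun N => A `&` F k N).
    by move=> m n mn; apply/subsetPset; apply: setIS; apply/subsetPset; exact: ndF.
  have UE : \bigcup_N (A `&` F k N) = A by rewrite -setI_bigcupr; apply/setIidPl; exact: AF.
  have mU : measurable (\bigcup_N (A `&` F k N)) by rewrite UE.
  have cv : (P \o (fun N => A `&` F k N)) @ \oo --> p%:E.
    have -> : p%:E = P (\bigcup_N (A `&` F k N)) by rewrite UE fineK ?fin_num_measure.
    exact: nondecreasing_cvg_mu.
  have cv' : (fine \o (P \o (fun N => A `&` F k N))) @ \oo --> p by exact: fine_cvg cv.
  have /cvgrPdist_le/(_ _ e0)[N _ hN] := cv'.
  exists N; have := hN N (leqnn N) => /=; rewrite ler_norml => /andP[_ h].
  have E : P A = (P (A `&` F k N) + P (A `\` F k N))%E.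
    by rewrite addeC; exact: measureDI.
  have E' : p = fine (P (A `&` F k N)) + fine (P (A `\` F k N)).
    by rewrite /p E fineD ?fin_num_measure //; exact: measurableD.
  rewrite -[leLHS]fineK ?fin_num_measure ?lee_fin //; last exact: measurableD.
  by move: h; rewrite E'; lra.
have [N hN] := choice ex.
exists N; set A' := _ `&` _.
have mA' : measurable A' by apply: measurableI => //; apply: bigcapT_measurable.
rewrite lt_neqAle fine_ge0 // andbT eq_sym; apply/negP => /eqP p0.
have PA'0 : P A' = 0%E by rewrite -[LHS]fineK ?fin_num_measure // p0.
have mD k : measurable (A `\` F k (N k)) by exact: measurableD.
have mDU : measurable (\bigcup_k (A `\` F k (N k))) by exact: bigcupT_measurable.
have sub : A `<=` A' `|` \bigcup_k (A `\` F k (N k)).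
  move=> w Aw; have [h|/existsNP[k hk]] := pselect (forall k, F k (N k) w).
    by left; split=> // k _; exact: h.
  by right; exists k => //; split.
have : (P A <= (p / 2)%:E)%E.
  apply: (@le_trans _ _ (P (A' `|` \bigcup_k (A `\` F k (N k))))).
    by apply: le_measure; rewrite ?inE //; exact: measurableU.
  have U2 : (P (A' `|` \bigcup_k (A `\` F k (N k))) <=
      P A' + P (\bigcup_k (A `\` F k (N k))))%E by exact: measureU2.
  apply: le_trans U2 _; rewrite PA'0 add0e.
  have U3 : (P (\bigcup_k (A `\` F k (N k))) <= \sum_(k <oo) P (A `\` F k (N k)))%E.
    exact: measure_sigma_subadditive.
  apply: le_trans U3 _.
  have p2 : 0 <= p / 2 by rewrite divr_ge0 // ltW.
  apply: le_trans (epsilon_trick0 xpredT p2).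
  by apply: lee_nneseries => // k _; exact: hN.
rewrite -[leLHS]fineK ?fin_num_measure // lee_fin -/p; lra.
Qed.

(** * Multi-indices listed by weight *)

Section weight_enumeration.
Variable r : nat.
Local Notation I := (multi_index r).

Definition wblock (k : nat) : seq I := finmap.enum_fset (fset_set [set m : I | weight m = k]).

(** Weights run over [m < k <= n], so consecutive lists concatenate and [wseq 0 N] carries the
    Dirichlet partial sum up to [N]. *)
Definition wseq (m n : nat) : seq I := flatten [seq wblock k | k <- index_iota m.+1 n.+1].

Lemma mem_wblock k i : (i \in wblock k) = (weight i == k).
Proof.
rewrite /wblock in_fset_set; last exact: finite_weight.
by apply/idP/eqP => [/set_mem//|wk]; apply/mem_set.
Qed.

Lemma wseq_uniq m n : uniq (wseq m n).
Proof.
rewrite /wseq; have : uniq (index_iota m.+1 n.+1) by exact: iota_uniq.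
elim: (index_iota _ _) => [//|k s IH] /= /andP[ks us].
rewrite cat_uniq IH // andbT finmap.fset_uniq /=.
apply/hasPn => i /flatten_mapP[k' k's]; rewrite mem_wblock => /eqP ik'.
by rewrite mem_wblock ik'; apply: contra ks => /eqP <-.
Qed.

Lemma wseq_cat m n k : (m <= n)%N -> (n <= k)%N -> wseq m k = wseq m n ++ wseq n k.
Proof.
move=> mn nk; rewrite /wseq -flatten_cat -map_cat /index_iota !subSS; congr (flatten (map _ _)).
have -> : (k - m = (n - m) + (k - n))%N by rewrite addnC addnBA // subnK.
by rewrite iotaD addSn subnKC.
Qed.

(** Ungrouping the random coefficients turns a Dirichlet partial sum into a linear combination of
    independent signs, to which the results on lists apply. *)
Lemma sum_Ycoef (Omega : Type) (R : realType) (eps : I -> Omega -> R) (X : I -> R)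
    (w : Omega) (u : nat -> R) (N : nat) :
  \sum_(1 <= n < N.+1) Ycoef eps X w n * u n =
  \sum_(i <- wseq 0 N) (X i * u (weight i)) * eps i w.
Proof.
rewrite /wseq big_flatten big_map /=; apply: eq_bigr => n _.
rewrite /Ycoef fsbig_finite; last exact: finite_weight.
rewrite big_distrl /= [LHS]big_seq [RHS]big_seq; apply: eq_bigr => i.
by rewrite -/(wblock n) mem_wblock => /eqP ->; ring.
Qed.

End weight_enumeration.

Lemma measurable_norm_le (d : measure_display) (T : measurableType d) (R : realType)
  (f : T -> R) (b : R) : bounded_mfun f -> measurable [set w | `|f w| <= b].
Proof.
move=> [mf _]; rewrite (_ : mkset _ = f @^-1` `[- b, b]%classic).
  by rewrite -[X in measurable X]setTI; exact: mf.
by apply/seteqP; split=> w /=; rewrite in_itv /= ler_norml.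
Qed.

Lemma ae_exists (d : measure_display) (T : measurableType d) (R : realType)
  (P : probability T R) (Q : T -> Prop) : {ae P, forall w, Q w} -> exists w, Q w.
Proof.
move=> [B [mB PB0 sub]]; apply/not_existsP => h.
have BT : B = setT by apply/seteqP; split=> // w _; apply: sub; exact: h.
have : P setT = 0%E by rewrite -BT.
by rewrite probability_setT => /eqP; rewrite onee_eq0.
Qed.

Lemma pow_fact_le_expR (R : realType) (x : R) k : 0 <= x -> x ^+ k / k`!%:R <= expR x.
Proof.
case: k => [|k] x0; first by rewrite expr0 fact0 divr1 -expR0 ler_expR.
by have := expR_ge1Dxn k x0; lra.
Qed.

(** * The coefficient bounds have probability zero *)

Section null_event.
Context (d : measure_display) (Omega : measurableType d) (R : realType)
  (P : probability Omega R) (r : nat) (eps : multi_index r -> {RV P >-> R}).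
Hypotheses (eps_val : forall m w, eps m w = 1 \/ eps m w = -1)
  (eps_pos : forall m, P [set w | eps m w = 1] = (2^-1)%:E)
  (eps_neg : forall m, P [set w | eps m w = -1] = (2^-1)%:E)
  (eps_indep : mutually_independent eps).
Variables (X : multi_index r -> R) (sigma eta t C : R).
Hypotheses (eta0 : 0 < eta)
  (hsigma : {ae P, forall w, abscissa_cvg (Ycoef eps X w) = sigma%:E}).

Let coef (phi : R -> R) (k n : nat) : R :=
  expR (- ((sigma + eta) * ln n%:R)) * phi (t * ln n%:R) * ln n%:R ^+ k / k`!%:R.

(** The conclusion of [dirichlet_continuation_bound] for one choice of parameters. Unlike
    continuability, it is expressed by countable unions and intersections of events on finitely many
    signs. *)
Definition coef_bounded (w : Omega) := forall k, exists N0, forall N, (N0 <= N)%N ->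
  `|\sum_(1 <= n < N.+1) Ycoef eps X w n * (expR (- ((sigma + eta) * ln n%:R)) *
      cos (t * ln n%:R) * ln n%:R ^+ k / k`!%:R)| <= C / (2 * eta) ^+ k /\
  `|\sum_(1 <= n < N.+1) Ycoef eps X w n * (expR (- ((sigma + eta) * ln n%:R)) *
      sin (t * ln n%:R) * ln n%:R ^+ k / k`!%:R)| <= C / (2 * eta) ^+ k.

Let beta k := C / (2 * eta) ^+ k.
Let c phi k i := X i * coef phi k (weight i).
Let S phi k N w := \sum_(i <- wseq r 0 N) c phi k i * eps i w.
Let lw (i : multi_index r) : R := ln (weight i)%:R.
Let v i := (X i * expR (- ((sigma + eta) * lw i))) ^+ 2.

Let bounded_mfun_lin s (a : multi_index r -> R) : bounded_mfun (fun w => \sum_(i <- s) a i * eps i w).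
Proof.
by apply: bounded_mfun_sum => i; apply: bounded_mfunM; [exact: bounded_mfun_cst|exact: bounded_mfun_eps].
Qed.

Let sum_coefE phi k N w :
  \sum_(1 <= n < N.+1) Ycoef eps X w n * coef phi k n = S phi k N w.
Proof. exact: sum_Ycoef. Qed.

Let G k M := [set w | `|S cos k M w| <= beta k] `&` [set w | `|S sin k M w| <= beta k].
Let F k N := \bigcap_(M in [set M | (N <= M)%N]) G k M.

Let measurable_F k N : measurable (F k N).
Proof.
apply: bigcap_measurable; first by exists N => /=.
by move=> M _; apply: measurableI; apply: measurable_norm_le; exact: bounded_mfun_lin.
Qed.

Let coef_boundedE : [set w | coef_bounded w] = \bigcap_k \bigcup_N F k N.
Proof.
apply/seteqP; split=> w /= H.
  move=> k _; have [N0 hN0] := H k; exists N0 => // M /= /hN0[h1 h2].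
  by split; rewrite /= -sum_coefE.
move=> k; have [N0 _ hN0] := H k I; exists N0 => M /hN0[h1 h2].
by split; rewrite sum_Ycoef.
Qed.

Let measurable_coef_bounded : measurable [set w | coef_bounded w].
Proof.
rewrite coef_boundedE; apply: bigcapT_measurable => k.
by apply: bigcupT_measurable => N; exact: measurable_F.
Qed.

Let lw_ge0 i : 0 <= lw i.
Proof.
rewrite /lw; have [->|i0] := eqVneq (weight i) 0%N; first by rewrite ln0.
by rewrite ln_ge0 // ler1n lt0n.
Qed.

(* The head of the series contributes an entire function of [s]. *)
Let head_bound phi N0 : (forall x, `|phi x| <= 1) ->
  exists2 H : R, 0 <= H & forall k w, `|S phi k N0 w| <= H / (2 * eta) ^+ k.
Proof.
move=> hphi.
(* The [k]-th term of the exponential series of [2 * eta * lw i] is at most its sum, which bounds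
   [lw i ^+ k] over the factorial by a constant times [(2 * eta) ^- k]. *)
pose h i := `|X i| * expR (- ((sigma + eta) * lw i)) * expR (2 * eta * lw i).
have h0 i : 0 <= h i by rewrite !mulr_ge0 ?expR_ge0.
exists (\sum_(i <- wseq r 0 N0) h i); first by apply: sumr_ge0 => i _.
move=> k w; apply: le_trans (ler_norm_sum _ _ _) _.
rewrite big_distrl /=; apply: ler_sum => i _.
have -> : `|c phi k i * eps i w| = `|c phi k i|.
  by rewrite normrM; case: (eps_val i w) => ->; rewrite ?normrN normr1 mulr1.
rewrite /c /coef !normrM -/(lw i) (ger0_norm (expR_ge0 _)).
rewrite (ger0_norm (exprn_ge0 k (lw_ge0 i))) normfV (ger0_norm (ler0n _ _)).
have p0 : 0 < (2 * eta) ^+ k by rewrite exprn_gt0 // mulr_gt0.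
have -> : `|X i| * (expR (- ((sigma + eta) * lw i)) * `|phi (t * lw i)| * lw i ^+ k / k`!%:R) =
  `|X i| * expR (- ((sigma + eta) * lw i)) * (`|phi (t * lw i)| * (lw i ^+ k / k`!%:R)) by ring.
rewrite /h -[leRHS]mulrA; apply: ler_wpM2l; first by rewrite mulr_ge0 ?expR_ge0.
have u0 : 0 <= 2 * eta * lw i by rewrite !mulr_ge0 // ltW.
rewrite ler_pdivlMr //; apply: le_trans (pow_fact_le_expR k u0).
rewrite [X in _ <= X / _]exprMn; have L0 : 0 <= lw i ^+ k / k`!%:R by rewrite divr_ge0 ?exprn_ge0.
have -> : (2 * eta) ^+ k * lw i ^+ k / k`!%:R = 1 * (lw i ^+ k / k`!%:R) * (2 * eta) ^+ k by ring.
by rewrite ler_pM2r // ler_wpM2r.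
Qed.

(** On an event [A] with uniform ranks, removing the head leaves tails bounded by
    [D0 / (2 * eta) ^+ k]. Their second moments over [A] dominate a fixed fraction of the sums of
    squares, and [weighted_exp_sum_bound] combines the resulting bounds for all [k]. *)
Let sum_bounded : 0 < fine (P [set w | coef_bounded w]) ->
  exists N0 D, forall M, (N0 <= M)%N ->
    \sum_(i <- wseq r N0 M) v i * expR (9 / 4 * eta * lw i) <= D.
Proof.
move=> pE.
have ndF k : nondecreasing_seq (F k).
  move=> m n mn; apply/subsetPset => w Fw M /= nM; apply: Fw => /=; exact: leq_trans nM.
have subF k : [set w | coef_bounded w] `<=` \bigcup_N F k N.
  by rewrite coef_boundedE => w; exact.
have [Nk pA] := egorov_choice measurable_coef_bounded measurable_F ndF subF pE.
set A := _ `&` _ in pA.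
have mA : measurable A.
  by apply: measurableI => //; apply: bigcapT_measurable => k; exact: measurable_F.
have AF k w M : A w -> (Nk k <= M)%N -> `|S cos k M w| <= beta k /\ `|S sin k M w| <= beta k.
  by move=> [_ hw] kM; have [] := hw k I M kM.
(* [N0] depends on [A] alone, so one and the same head is removed for every [k]. *)
have [N0 hN0] := Ex_sqr_tail eps_val eps_pos eps_neg eps_indep (@wseq_uniq r)
  (fun m n => @wseq_cat r 0 m n (leq0n m)) mA pA.
set p := fine (P A) in pA hN0.
have [Hc Hc0 hHc] := @head_bound cos N0 (@cos_max R).
have [Hs Hs0 hHs] := @head_bound sin N0 (@sin_max R).
pose D0 := `|C| + Hc + Hs.
have D00 : 0 <= D0 by rewrite !addr_ge0.
have p0 k : 0 < (2 * eta) ^+ k by rewrite exprn_gt0 // mulr_gt0.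
have tail phi k M H : (forall w, A w -> `|S phi k M w| <= beta k) ->
    0 <= H -> H <= Hc + Hs -> (forall k w, `|S phi k N0 w| <= H / (2 * eta) ^+ k) -> (N0 <= M)%N ->
    p / 2 * \sum_(i <- wseq r N0 M) c phi k i ^+ 2 <= (D0 / (2 * eta) ^+ k) ^+ 2.
  move=> hS H0 HH hH NM; apply: le_trans (hN0 M (c phi k) NM) _.
  have bA : bounded_mfun (\1_A : Omega -> R) by exact: bounded_mfun_indic.
  have q0 : 0 <= D0 / (2 * eta) ^+ k by rewrite divr_ge0 // ltW.
  rewrite -[leRHS](Ex_cst P); apply: le_Ex; last first.
  - move=> w; rewrite indicE; have [Aw|Aw] := boolP (w \in A); last by rewrite mul0r sqr_ge0.
    rewrite mul1r -[leLHS]real_normK ?num_real // ler_sqr ?nnegrE //.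
    have -> : \sum_(i <- wseq r N0 M) c phi k i * eps i w = S phi k M w - S phi k N0 w.
      by rewrite /S (wseq_cat r (leq0n N0) NM) big_cat /=; ring.
    apply: le_trans (ler_normB _ _) _.
    apply: le_trans (lerD (hS w (set_mem Aw)) (hH k w)) _.
    rewrite /beta -mulrDl ler_pM2r ?invr_gt0 // /D0.
    by have := ler_norm C; lra.
  - exact: bounded_mfun_cst.
  - by apply: bounded_mfunM => //; rewrite (_ : (fun _ => _) = (fun w =>
      (\sum_(i <- wseq r N0 M) c phi k i * eps i w) * (\sum_(i <- wseq r N0 M) c phi k i * eps i w)));
      [apply: bounded_mfunM; exact: bounded_mfun_lin|apply/funext => w; rewrite expr2].
(* The cosine and sine parts each contribute [D0 ^+ 2 / (p / 2)]. *)
pose D := 4 * D0 ^+ 2 / p.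
have vE k i : c cos k i ^+ 2 + c sin k i ^+ 2 = v i * (lw i ^+ k / k`!%:R) ^+ 2.
  rewrite /c /coef /v -/(lw i).
  set e := expR _; set q := lw i ^+ k; set f := (_`!%:R)^-1.
  rewrite -[RHS]mulr1 -(cos2Dsin2 (t * lw i)); ring.
have v0 i : 0 <= v i by exact: sqr_ge0.
exists N0, (16 * D) => M NM; apply: weighted_exp_sum_bound => // k.
(* The bounds on [A] hold only from rank [Nk k] on, which may exceed [M]. Enlarging the range to
   [M'] only adds nonnegative terms. *)
pose M' := maxn M (Nk k).
have MM' : (M <= M')%N by exact: leq_maxl.
have NM' : (N0 <= M')%N by exact: leq_trans MM'.
have hcs w (Aw : A w) := AF k w M' Aw (leq_maxr _ _).
have Tc := tail cos k M' Hc (fun w Aw => (hcs w Aw).1) Hc0 (ltac:(lra)) hHc NM'.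
have Ts := tail sin k M' Hs (fun w Aw => (hcs w Aw).2) Hs0 (ltac:(lra)) hHs NM'.
apply: (@le_trans _ _ (\sum_(i <- wseq r N0 M') v i * (lw i ^+ k / k`!%:R) ^+ 2)).
  rewrite (wseq_cat r NM MM') big_cat /= lerDl; apply: sumr_ge0 => i _.
  by rewrite mulr_ge0 // sqr_ge0.
under eq_bigr do rewrite -vE.
rewrite big_split /=.
have -> : D / ((2 * eta) ^+ k) ^+ 2 = (2 * (D0 / (2 * eta) ^+ k) ^+ 2) / (p / 2).
  by rewrite /D; field; rewrite !gt_eqF.
rewrite ler_pdivlMr ?divr_gt0 //; move: Tc Ts; lra.
Qed.

(** Otherwise the variances are summable at an abscissa below [sigma]. The series then converges
    there almost surely, and any outcome at which the abscissa also equals [sigma] is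
    contradictory. *)
Lemma coef_bounded_null : {ae P, forall w, ~ coef_bounded w}.
Proof.
suff PE0 : P [set w | coef_bounded w] = 0%E.
  exists [set w | coef_bounded w]; split=> // w /=; exact: contrapT.
apply/eqP; rewrite eq_le measure_ge0 andbT leNgt; apply/negP => PE.
have pE : 0 < fine (P [set w | coef_bounded w]).
  by rewrite fine_gt0 // PE /= ltey_eq fin_num_measure.
have [N0 [D hD]] := sum_bounded pE.
(* Determined by [2 * sg = 2 * (sigma + eta) - 9 / 4 * eta], the exponent left after the exponential
   gain. *)
pose sg := sigma - eta / 8.
pose a i := X i * expR (- (sg * lw i)).
have aE i : a i ^+ 2 = v i * expR (9 / 4 * eta * lw i).
  rewrite /a /v !exprMn -[RHS]mulrA; congr (_ * _); rewrite -!expRM_natl -expRD.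
  by congr expR; rewrite /sg; field.
have K N : \sum_(i <- wseq r 0 N) a i ^+ 2 <= \sum_(i <- wseq r 0 N0) a i ^+ 2 + `|D|.
  have [NN|/ltnW NN] := leqP N0 N.
    rewrite (wseq_cat r (leq0n N0) NN) big_cat /= lerD2l.
    by under eq_bigr do rewrite aE; apply: le_trans (hD N NN) (ler_norm D).
  rewrite (wseq_cat r (leq0n N) NN) big_cat /= -addrA lerDl addr_ge0 //.
  by apply: sumr_ge0 => i _; exact: sqr_ge0.
have cau := rademacher_ae_cauchy eps_val eps_pos eps_neg eps_indep (@wseq_uniq r) (@wseq_cat r) K.
have [w [hw1 hw2]] := ae_exists (filterI hsigma cau).
have : (abscissa_cvg (Ycoef eps X w) <= sg%:E)%E.
  apply: abscissa_le_of_cauchy => e e0; have [N hN] := hw2 e e0.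
  exists N => n m Nn nm.
  by rewrite !(sum_Ycoef _ _ _ (fun n => expR (- (sg * ln n%:R)))); exact: hN.
rewrite hw1 lee_fin /sg => h; have := eta0; lra.
Qed.

End null_event.

Theorem theorem1 (d : measure_display) (Omega : measurableType d)
    (R : realType) (P : probability Omega R) (r : nat) (hr : (0 < r)%N)
    (eps : multi_index r -> {RV P >-> R})
    (eps_val : forall m w, eps m w = 1 \/ eps m w = -1)
    (eps_pos : forall m, P [set w | eps m w = 1] = (2^-1)%:E)
    (eps_neg : forall m, P [set w | eps m w = -1] = (2^-1)%:E)
    (eps_indep : mutually_independent eps)
    (X : multi_index r -> R)
    (sigma : \bar R)
    (hsigma : {ae P, forall w, abscissa_cvg (Ycoef eps X w) = sigma})
    (sigma_fin : (-oo < sigma < +oo)%E) :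
  {ae P, forall w,
    natural_boundary (fine sigma) (dirichlet_sum (Ycoef eps X w))}.
Proof.
have sE : sigma = (fine sigma)%:E.
  by rewrite fineK // fin_real.
move: (fine sigma) sE hsigma => sg -> hs.
(* The countable set of triples is numbered by [pickle], so that [ae_foralln] treats them all;
   integers that code no triple impose nothing. *)
pose Q n w := if @unpickle (nat * rat * nat)%type n is Some (j, t, C) then
  ~ coef_bounded eps X sg j.+1%:R^-1 (ratr t) C%:R w else True.
have hQ : {ae P, forall w, forall n, Q n w}.
  apply: ae_foralln => n; rewrite /Q; case: unpickle => [[[j t] C]|]; last exact: aeW.
  by apply: coef_bounded_null => //; rewrite invr_gt0 ltr0n.
apply: filterS2 hs hQ => w hw hQw s0 s0s cont.
have [j [t [C H]]] := dirichlet_continuation_bound hw s0s cont.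
by have := hQw (pickle (j, t, C)); rewrite /Q pickleK; apply.
Qed.
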